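(* Let $p\ge1$ be an integer and let $(\beta_n)_{n\ge0}$ be a periodic family of Verblunsky coefficients in $\mathbb{D}$ of period $p$, i.e. $\beta_n=\beta_{n+p}$ for all $n$, with associated measure $d\mu_\beta$. Let $\Gamma_\beta\subset\partial\mathbb{D}$ be the union of the open arcs which are the interiors of the bands that form the essential support of $d\mu_\beta$. Suppose the probability measure $d\mu$ on $\partial\mathbb{D}$ has Verblunsky coefficients $(\alpha_n)_{n\ge0}$ satisfying $$\lim_{n\to\infty}(\alpha_n-\beta_n)=0,\qquad \sum_{n=0}^\infty|\alpha_{n+p}-\alpha_n|<\infty .$$ Let $\zeta\in\partial\mathbb{D}\setminus\overline{\Gamma_\beta}$, $0<\gamma<1$, and $d\nu=(1-\gamma)\,d\mu+\gamma\,\delta_\zeta$. Then one of the following is true: (1) $\mu(\{\zeta\})>0$, and for each fixed $0\le j<p$, $\lim_{k\to\infty}\Delta_{kp+j}(\zeta)=0$ exponentially fast. (2) $\mu(\{\zeta\})=0$, and for each fixed $0\le j<p$, $\lim_{k\to\infty}\Delta_{kp+j}(\zeta)$ exists and $$\sum_{k=0}^\infty|\Delta_{(k+1)p+j}(\zeta)-\Delta_{kp+j}(\zeta)|<\infty .$$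
   Context: $\mathbb{D}$ is the open unit disc in $\mathbb{C}$ and $\partial\mathbb{D}$ the unit circle. For a probability measure $d\mu$ on $\partial\mathbb{D}$ with infinite support, $\Phi_n(z)$ are the monic orthogonal polynomials in $L^2(\partial\mathbb{D},d\mu)$, $\varphi_n=\Phi_n/\|\Phi_n\|_{d\mu}$ the orthonormal polynomials, $\Phi_n^*(z)=z^n\overline{\Phi_n(1/\bar z)}$ and $\varphi_n^*(z)=z^n\overline{\varphi_n(1/\bar z)}$. The Verblunsky coefficients $\alpha_n=\alpha_n(d\mu)\in\mathbb{D}$, $n\ge0$, are defined by $\Phi_{n+1}(z)=z\Phi_n(z)-\overline{\alpha_n}\Phi_n^*(z)$; every sequence in $\mathbb{D}$ is the sequence of Verblunsky coefficients of a unique such measure. Objects without the label $(d\nu)$ are associated with $d\mu$. For $\zeta\in\partial\mathbb{D}$ and $0<\gamma<1$, $$\Delta_n(\zeta)=\frac{(1-|\alpha_n|^2)^{1/2}\,\overline{\varphi_{n+1}(\zeta)}\,\varphi_n^*(\zeta)}{(1-\gamma)\gamma^{-1}+K_n(\zeta,\zeta)},\qquad K_n(\zeta,\zeta)=\sum_{j=0}^n|\varphi_j(\zeta)|^2 ,$$ and it is known that $\alpha_n(d\nu)=\alpha_n(d\mu)+\Delta_n(\zeta)$ for $d\nu=(1-\gamma)d\mu+\gamma\delta_\zeta$. Bands: for $\beta\in\mathbb{D}$ put $A(\beta,z)=(1-|\beta|^2)^{-1/2}\begin{pmatrix} z&-\overline{\beta}\\-z\beta&1\end{pmatrix}$ and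 $T_p(z)=A(\beta_{p-1},z)\cdots A(\beta_0,z)$. The set $\{e^{i\theta}:|\mathrm{Tr}\,T_p(e^{i\theta})|\le2\}$ is a union of $p$ closed arcs $B_1,\dots,B_p$ (the bands), which can overlap only at endpoints; this union is the essential support of the absolutely continuous spectrum of $d\mu_\beta$. A sequence $(a_k)$ tends to zero exponentially fast if $|a_k|\le Cr^k$ for some $C>0$, $0<r<1$. *)

(* Defs.v *)
From HB Require Import structures.
From mathcomp Require Import all_boot all_order all_algebra.
From mathcomp Require Import all_classical all_reals all_analysis.
From mathcomp Require Export complex.
Set Implicit Arguments.
Unset Strict Implicit.
Unset Printing Implicit Defensive.
Import Order.TTheory GRing.Theory Num.Theory.
Import numFieldNormedType.Exports.
Local Open Scope classical_set_scope.
Local Open Scope ring_scope.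
Local Open Scope complex_scope.

(* The norm [`|z|] of R[i] takes its values in R[i]; [cmod z : R] is the modulus
   as a real number. *)
Notation cmod := ComplexField.Normc.normc.

(* ** The unit circle as a topological and Borel space *)

Definition unit_circle (R : realType) : Type := {z : R[i] | `|z| == 1}.

Section UnitCircle.
Variable R : realType.

HB.instance Definition _ := Choice.on (unit_circle R).

Definition circle_val (z : unit_circle R) : R[i]^o := sval z.

Lemma circle_one_subproof : `|1 : R[i]| == 1.
Proof. by rewrite normr1. Qed.

HB.instance Definition _ := isPointed.Build (unit_circle R)
  (exist (fun z : R[i] => `|z| == 1) 1 circle_one_subproof).

(* Subspace topology inherited from the complex plane. *)
HB.instance Definition _ :=
  Topological.copy (unit_circle R) (initial_topology circle_val).

End UnitCircle.

Notation borel_circle R := (g_sigma_algebraType (@open (unit_circle R))).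

Section OPUC.
Variable R : realType.
Local Notation C := R[i].

Section Measure.
Variable mu : probability (borel_circle R) R.

Definition msupport : set (unit_circle R) :=
  [set z | forall U, open U -> U z -> (0 < mu U)%E].

Definition cintegral (f : unit_circle R -> C) : C :=
  (Rintegral mu setT (fun z => complex.Re (f z)))
    +i* (Rintegral mu setT (fun z => complex.Im (f z))).

Definition pinner (p q : {poly C}) : C :=
  cintegral (fun z => (p.[circle_val z])^* * q.[circle_val z]).

Definition pnorm (p : {poly C}) : R :=
  Num.sqrt (Rintegral mu setT (fun z => cmod p.[circle_val z] ^+ 2)).

Definition monic_orthogonal (Phi : nat -> {poly C}) : Prop :=
  [/\ forall n, Phi n \is monic,
      forall n, size (Phi n) = n.+1
    & forall m n, m != n -> pinner (Phi m) (Phi n) = 0].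

Definition orthonormal_of (Phi : nat -> {poly C}) (n : nat) : {poly C} :=
  ((pnorm (Phi n))^-1)%:C *: Phi n.

End Measure.

(* Meaningful for z != 0 only: at the origin, [x / 0 = 0] makes the formula
   differ from the value of the reversed polynomial. *)
Definition reversed (n : nat) (p : {poly C}) (z : C) : C :=
  z ^+ n * (p.[1 / z^*])^*.

(* An identity between polynomials in z; see [reversed] for z != 0. *)
Definition verblunsky (Phi : nat -> {poly C}) (alpha : nat -> C) : Prop :=
  forall n (z : C), z != 0 ->
    (Phi n.+1).[z] = z * (Phi n).[z] - (alpha n)^* * reversed n (Phi n) z.

Definition CDkernel (phi : nat -> {poly C}) (n : nat) (z : C) : R :=
  \sum_(0 <= j < n.+1) cmod (phi j).[z] ^+ 2.

Definition Delta (mu : probability (borel_circle R) R)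
    (Phi : nat -> {poly C}) (alpha : nat -> C) (gamma : R)
    (zeta : unit_circle R) (n : nat) : C :=
  let z : C := circle_val zeta in
  let phi := orthonormal_of mu Phi in
  (Num.sqrt (1 - cmod (alpha n) ^+ 2))%:C
    * ((phi n.+1).[z])^* * reversed n (phi n) z
  / ((1 - gamma) * gamma^-1 + CDkernel phi n z)%:C.

Definition szego_mx (b z : C) : 'M[C]_2 :=
  ((Num.sqrt (1 - cmod b ^+ 2))^-1)%:C *:
  \matrix_(i < 2, j < 2)
    (if i == 0 then if j == 0 then z else - b^*
     else if j == 0 then - (z * b) else 1).

Fixpoint transfer_mx (beta : nat -> C) (n : nat) (z : C) : 'M[C]_2 :=
  if n is m.+1 then szego_mx (beta m) z *m transfer_mx beta m z else 1%:M.

Definition expi (t : R) : C := cos t +i* sin t.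

Definition open_arc (a b : R) : set C := expi @` [set t | a < t < b].

(* The closed arc [{expi t | a <= t <= b}] is a band: the closure of a component
   of {|Tr T_p| < 2} in the circle, with |Tr T_p| = 2 at both endpoints. Two bands
   that meet at a closed gap thus count as two. A single band may be the whole
   circle, with coinciding endpoints. *)
Definition is_band (beta : nat -> C) (p : nat) (a b : R) : Prop :=
  let trT t := cmod (\tr (transfer_mx beta p (expi t))) in
  [/\ a < b <= a + 2 * pi, trT a = 2, trT b = 2
    & forall t, a < t < b -> trT t < 2].

(* The union over all bands of the open arcs obtained by removing their
   endpoints. *)
Definition Gamma_bands (beta : nat -> C) (p : nat) : set C :=
  [set z | exists a b, is_band beta p a b /\ open_arc a b z].

Definition exponentially_fast (a : nat -> C) : Prop :=
  exists c r : R, [/\ 0 < c, 0 < r < 1 & forall k, cmod (a k) <= c * r ^+ k].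

End OPUC.

(* Main.v *)
Require Import Defs.
From HB Require Import structures.
From mathcomp Require Import all_boot all_order all_algebra.
From mathcomp Require Import all_classical all_reals all_analysis.
From mathcomp Require Import measurable_realfun ring lra zify.
Import Order.TTheory GRing.Theory Num.Theory.
Import numFieldNormedType.Exports.
Local Open Scope classical_set_scope.
Local Open Scope ring_scope.
Local Open Scope complex_scope.

(** Write zeta = s^2 with |s| = 1 and F_n = s^-n phi_n(zeta). The Szego recursion
    then reads F_(n+1) = (s F_n - conj (alpha_n s F_n)) / rho_n: a product of maps
    F |-> a F + b conj F with |a|^2 - |b|^2 = 1, that is, of real 2 x 2 matrices of
    determinant 1. With W_n = conj F_n / F_n and
    S_n = ((1 - gamma) / gamma + K_n) / |F_n|^2 one has
    Delta_n = (conj zeta W_n - alpha_n) / S_n, so the behaviour of Delta is that of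
    the orbit F.

    Off the closed bands the p-step matrix of the periodic sequence, normalised by
    s^-p to have determinant 1, has a real trace of modulus greater than 2
    ([hyperbolic_off_bands]). Indeed the trace, as a real function of the angle,
    is critical inside [-2, 2] only where the normalised matrix is 1 or -1, and there
    it is a strict local extremum equal to 2 or -2
    ([critical_central], [elliptic_dense]); so every angle at which the trace is in
    [-2, 2] is a limit of angles at which it is in (-2, 2), each inside a band.

    The p-step matrices along alpha converge to that hyperbolic matrix, and their
    increments are summable. By a cone argument ([dichotomy]) either F_(kp) decays
    geometrically, or F_(kp) grows and its direction W_(kp) has bounded variation. In
    the first case sum_n |F_n|^2 is finite and Delta decays with |F|^2
    ([decay_case]). In the second the sum is infinite, and S_(kp) obeys an affine
    recursion whose multiplier |F_(kp)|^2 / |F_((k+1)p)|^2 is eventually below a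
    constant less than 1, so that S_(kp) has bounded variation too ([bv_affine]).
    The one-step recursions carry bounded variation from the index kp to kp + j,
    and thereby to Delta_(kp+j) ([growth_case]).

    The two cases are told apart by the mass of zeta, since
    mu {zeta} = 1 / sum_n |phi_n(zeta)|^2 ([point_mass_of_summ],
    [no_point_mass_of_not_summ]). *)

Set Implicit Arguments.
Unset Strict Implicit.
Unset Printing Implicit Defensive.

(* Keeps the conjugations of the ring and complex scopes from being mixed. *)
Local Notation "x ^*" := (Num.conj x) : complex_scope.

(** * Moduli, summable sequences and bounded variation *)

Section Modulus.
Variable R : realType.
Local Notation C := R[i].
Implicit Types (x y z : C).

Lemma normE z : `|z| = (cmod z)%:C.
Proof. by rewrite normc_def; case: z. Qed.

Lemma cmod_ge0 z : 0 <= cmod z.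
Proof. by rewrite -ler0c -normE. Qed.

Lemma cmodD x y : cmod (x + y) <= cmod x + cmod y.
Proof. by rewrite -lecR rmorphD /= -!normE ler_normD. Qed.

Lemma cmodM x y : cmod (x * y) = cmod x * cmod y.
Proof. exact: ComplexField.Normc.normcM. Qed.

Lemma cmodV x : cmod x^-1 = (cmod x)^-1.
Proof. exact: ComplexField.Normc.normcV. Qed.

Lemma cmodN x : cmod (- x) = cmod x.
Proof. by apply: complexI; rewrite -!normE normrN. Qed.

Lemma cmodB x y : cmod (x - y) <= cmod x + cmod y.
Proof. by rewrite -(cmodN y) cmodD. Qed.

Lemma cmodC x y : cmod (x - y) = cmod (y - x).
Proof. by rewrite -cmodN opprB. Qed.

Lemma cmodX x n : cmod (x ^+ n) = cmod x ^+ n.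
Proof. by apply: complexI; rewrite -normE normrX normE rmorphXn. Qed.

Lemma cmod_conj x : cmod x^* = cmod x.
Proof. by apply: complexI; rewrite -!normE norm_conjC. Qed.

Lemma cmod0 : cmod (0 : C) = 0.
Proof. exact: ComplexField.Normc.normc0. Qed.

Lemma cmod1 : cmod (1 : C) = 1.
Proof. exact: ComplexField.Normc.normc1. Qed.

Lemma cmod_eq0 x : (cmod x == 0) = (x == 0).
Proof.
by apply/eqP/eqP => [/ComplexField.Normc.eq0_normc//|->]; rewrite cmod0.
Qed.

Lemma cmod_gt0 x : (0 < cmod x) = (x != 0).
Proof. by rewrite lt_def cmod_eq0 cmod_ge0 andbT. Qed.

Lemma cmod_real (r : R) : cmod r%:C = `|r|.
Proof. by rewrite /= expr0n addr0 sqrtr_sqr. Qed.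

Lemma sqr_cmod x : (cmod x ^+ 2)%:C = x * x^*.
Proof. by rewrite rmorphXn /= -normE normCK. Qed.

Lemma sqr_cmodE x : cmod x ^+ 2 = complex.Re x ^+ 2 + complex.Im x ^+ 2.
Proof. by case: x => a b /=; rewrite sqr_sqrtr // addr_ge0 ?sqr_ge0. Qed.

Lemma Re_le_cmod x : `|complex.Re x| <= cmod x.
Proof. by rewrite -lecR -normE normc_ge_Re. Qed.

Lemma Im_le_cmod x : `|complex.Im x| <= cmod x.
Proof.
rewrite -(ger0_norm (cmod_ge0 x)) -ler_sqr ?nnegrE ?normr_ge0 // !real_normK ?num_real //.
by rewrite sqr_cmodE lerDr sqr_ge0.
Qed.

Lemma cmod_le_ReIm x : cmod x <= `|complex.Re x| + `|complex.Im x|.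
Proof.
have -> : cmod x = cmod ((complex.Re x)%:C + 'i * (complex.Im x)%:C).
  by rewrite -complexE.
apply: le_trans (cmodD _ _) _; rewrite cmodM !cmod_real.
by rewrite /= expr0n add0r expr1n sqrtr1 mul1r.
Qed.

Lemma cmodB_ge x y : cmod x - cmod y <= cmod (x - y).
Proof. by rewrite lerBlDr; apply: le_trans (cmodD _ _); rewrite subrK. Qed.

Lemma ReD (x y : R[i]) : complex.Re (x + y) = complex.Re x + complex.Re y.
Proof. exact: raddfD. Qed.

Lemma ImD (x y : R[i]) : complex.Im (x + y) = complex.Im x + complex.Im y.
Proof. exact: raddfD. Qed.

Lemma Re_mul (x y : R[i]) : complex.Re (x * y) =
  complex.Re x * complex.Re y - complex.Im x * complex.Im y.
Proof. by case: x y => [a b] [c d]. Qed.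

Lemma Im_mul (x y : R[i]) : complex.Im (x * y) =
  complex.Re x * complex.Im y + complex.Im x * complex.Re y.
Proof. by case: x y => [a b] [c d]. Qed.

Lemma Re_conj (x : R[i]) : complex.Re x^* = complex.Re x.
Proof. by case: x. Qed.

Lemma Im_conj (x : R[i]) : complex.Im x^* = - complex.Im x.
Proof. by case: x. Qed.

Lemma conjc_realJ (r : R) : (r%:C)^* = r%:C :> R[i].
Proof. exact: conjc_real. Qed.

End Modulus.

Section Summable.
Variable R : realType.
Implicit Types (d e : nat -> R).

(** For nonnegative terms this is summability ([summP]); bounded partial sums are easier
    to propagate through recursive inequalities. *)
Definition summ d := exists M, forall n, \sum_(k < n) d k <= M.

Lemma summ_le d e : (forall k, d k <= e k) -> summ e -> summ d.
Proof.
move=> le [M hM]; exists M => n; apply: le_trans (hM n).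
by apply: ler_sum => k _.
Qed.

Lemma summD d e : summ d -> summ e -> summ (fun k => d k + e k).
Proof.
by move=> [M hM] [N hN]; exists (M + N) => n; rewrite big_split lerD.
Qed.

Lemma summZ c d : 0 <= c -> summ d -> summ (fun k => c * d k).
Proof.
by move=> c0 [M hM]; exists (c * M) => n; rewrite -mulr_sumr ler_wpM2l.
Qed.

Lemma summ_shift d N : (forall k, 0 <= d k) ->
  summ (fun k => d (N + k)%N) <-> summ d.
Proof.
move=> d0; split=> -[M hM].
  exists (\sum_(k < N) d k + M) => n.
  apply: (@le_trans _ _ (\sum_(k < N + n) d k)).
    by rewrite addnC big_split_ord /= lerDl sumr_ge0.
  by rewrite big_split_ord /= lerD2l; exact: hM.
exists M => n; have := hM (N + n)%N; apply: le_trans.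
by rewrite big_split_ord /= lerDr sumr_ge0.
Qed.

(** Summing the inequality, the partial sums satisfy S <= d_0 + kappa S + E. *)
Lemma summ_contraction d e kappa : (forall k, 0 <= d k) -> 0 <= kappa < 1 ->
  (forall k, d k.+1 <= kappa * d k + e k) -> summ e -> summ d.
Proof.
move=> d0 /andP[k0 k1] rec [M hM]; exists ((d 0%N + M) / (1 - kappa)) => n.
rewrite ler_pdivlMr ?subr_gt0 // mulrBr mulr1 lerBlDr mulrC.
apply: (@le_trans _ _ (\sum_(k < n.+1) d k)).
  by rewrite big_ord_recr lerDl.
rewrite big_ord_recl /= -addrA lerD2l addrC.
apply: le_trans (_ : \sum_(i < n) (kappa * d i + e i) <= _).
  by apply: ler_sum => i _; exact: rec.
by rewrite big_split /= -mulr_sumr lerD2l; exact: hM.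
Qed.

Lemma summP d : (forall k, 0 <= d k) ->
  summ d <-> (\sum_(0 <= k <oo) (d k)%:E < +oo)%E.
Proof.
move=> d0; split=> [[M hM]|fin].
  apply: (@le_lt_trans _ _ M%:E); last exact: ltry.
  apply: lime_le; first by apply: is_cvg_nneseries => k _ _; rewrite lee_fin.
  by apply: nearW => n; rewrite sumEFin lee_fin big_mkord.
exists (fine (\sum_(0 <= k <oo) (d k)%:E)%E) => n.
have ge0 : (0 <= \sum_(0 <= k <oo) (d k)%:E)%E.
  by apply: nneseries_ge0 => k _ _; rewrite lee_fin.
rewrite -lee_fin fineK ?ge0_fin_numE //.
rewrite -(big_mkord xpredT d) -sumEFin.
by apply: nneseries_lim_ge => k _; rewrite lee_fin.
Qed.

End Summable.

Section BoundedVariation.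
Variable R : realType.
Local Notation C := R[i].
Implicit Types (u v : nat -> C).

Definition bv u := summ (fun k => cmod (u k.+1 - u k)).

Lemma bv_bounded u : bv u -> exists2 B, 0 < B & forall k, cmod (u k) <= B.
Proof.
move=> [M hM]; exists (cmod (u 0%N) + M + 1).
  have := hM 0%N; rewrite big_ord0; have := cmod_ge0 (u 0%N); lra.
move=> k; suff : cmod (u k) <= cmod (u 0%N) + \sum_(i < k) cmod (u i.+1 - u i).
  by have := hM k; lra.
elim: k => [|k IH]; first by rewrite big_ord0 addr0.
rewrite big_ord_recr /=; have := cmodD (u k.+1 - u k) (u k).
by rewrite subrK; move: IH; lra.
Qed.

Lemma bv_shift u N : bv (fun k => u (N + k)%N) <-> bv u.
Proof.
rewrite -[bv u](propext (summ_shift N (fun k => cmod_ge0 (u k.+1 - u k)))).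
by rewrite /bv; under eq_fun do rewrite addnS.
Qed.

Lemma eq_bv u v : u =1 v -> bv u -> bv v.
Proof. by move=> /funext ->. Qed.

Lemma bv_cst c : bv (fun=> c).
Proof. by exists 0 => n; rewrite big1 // => i _; rewrite subrr cmod0. Qed.

Lemma bvD u v : bv u -> bv v -> bv (fun k => u k + v k).
Proof.
move=> hu hv; apply: summ_le (summD hu hv) => k.
by rewrite opprD addrACA cmodD.
Qed.

Lemma bvN u : bv u -> bv (fun k => - u k).
Proof. by apply: summ_le => k; rewrite -opprD cmodN. Qed.

Lemma bvB u v : bv u -> bv v -> bv (fun k => u k - v k).
Proof. by move=> hu /bvN; exact: bvD. Qed.

Lemma bv_conj u : bv u -> bv (fun k => (u k)^*).
Proof. by apply: summ_le => k; rewrite -rmorphB cmod_conj. Qed.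

Lemma bvM u v : bv u -> bv v -> bv (fun k => u k * v k).
Proof.
move=> hu hv; have [A A0 hA] := bv_bounded hu; have [B B0 hB] := bv_bounded hv.
apply: summ_le (summD (summZ (ltW A0) hv) (summZ (ltW B0) hu)) => k.
have -> : u k.+1 * v k.+1 - u k * v k =
  u k.+1 * (v k.+1 - v k) + v k * (u k.+1 - u k) by ring.
by apply: le_trans (cmodD _ _) _; rewrite !cmodM lerD // ler_wpM2r ?cmod_ge0.
Qed.

Lemma bvV u c : 0 < c -> (forall k, c <= cmod (u k)) -> bv u ->
  bv (fun k => (u k)^-1).
Proof.
move=> c0 hc hu; have c1 : 0 <= (c ^+ 2)^-1 by rewrite invr_ge0 sqr_ge0.
apply: summ_le (summZ c1 hu) => k.
have u0 j : u j != 0 by rewrite -cmod_gt0 (lt_le_trans c0).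
have -> : (u k.+1)^-1 - (u k)^-1 = (u k.+1 * u k)^-1 * (u k - u k.+1).
  by field; rewrite !u0.
rewrite cmodM cmodC ler_wpM2r ?cmod_ge0 // cmodV lef_pV2 ?posrE ?exprn_gt0 //.
  by rewrite cmodM expr2 ler_pM // ltW.
by rewrite cmod_gt0 mulf_neq0.
Qed.

Lemma bv_div u v c : 0 < c -> (forall k, c <= cmod (v k)) -> bv u -> bv v ->
  bv (fun k => u k / v k).
Proof. by move=> c0 hc hu hv; apply: bvM => //; exact: (bvV c0 hc). Qed.

End BoundedVariation.

(** * Limits and perturbed hyperbolic recursions *)

Section ComplexLimits.
Variable R : realType.
Implicit Types (u v : nat -> R[i]).

(** Stated with the real-valued modulus rather than as a filter limit in [R[i]^o],
    whose norm is itself complex-valued; [tendsP] gives the filter form. *)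
Definition tends u (l : R[i]) := forall eps : R, 0 < eps ->
  exists N, forall n, (N <= n)%N -> cmod (u n - l) < eps.

Lemma tendsP u l :
  tends u l <-> (u : nat -> R[i]^o) n @[n --> \oo] --> (l : R[i]^o).
Proof.
split=> [h|/cvgrPdist_lt h eps e0]; last first.
  have /h [N _ hN] : (0 : R[i]) < eps%:C by rewrite ltcR.
  by exists N => n /hN; rewrite normE ltcR cmodC.
apply/cvgrPdist_lt => /= e; rewrite ltcE /= => /andP[/eqP e1 e0].
have [N hN] := h _ e0; exists N => // n /= /hN.
by rewrite normE cmodC => ?; rewrite ltcE /= e1 eqxx.
Qed.

Lemma tends_cst (c : R[i]) : tends (fun=> c) c.
Proof. by move=> e e0; exists 0%N => n _; rewrite subrr cmod0. Qed.

Lemma tendsD u v (a b : R[i]) : tends u a -> tends v b ->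
  tends (fun n => u n + v n) (a + b).
Proof.
move=> /tendsP h1 /tendsP h2; apply/tendsP.
exact: (@cvgD R[i] R[i]^o nat \oo _ u v a b h1 h2).
Qed.

Lemma tendsN u (a : R[i]) : tends u a -> tends (fun n => - u n) (- a).
Proof. by move=> h e /h [N hN]; exists N => n /hN; rewrite -opprD cmodN. Qed.

Lemma tendsB u v (a b : R[i]) : tends u a -> tends v b ->
  tends (fun n => u n - v n) (a - b).
Proof. by move=> hu /tendsN; exact: tendsD. Qed.

Lemma tendsM u v (a b : R[i]) : tends u a -> tends v b ->
  tends (fun n => u n * v n) (a * b).
Proof.
move=> /tendsP h1 /tendsP h2; apply/tendsP.
exact: (@cvgM R[i] nat \oo _ u v a b h1 h2).
Qed.

Lemma tendsV u (a : R[i]) : a != 0 -> tends u a ->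
  tends (fun n => (u n)^-1) (a^-1).
Proof. by move=> a0 /tendsP h1; apply/tendsP; apply: (@cvgV R[i]). Qed.

Lemma tends_unique u (a b : R[i]) : tends u a -> tends u b -> a = b.
Proof. by move=> /tendsP h1 /tendsP h2; exact: (cvg_unique _ h1 h2). Qed.

Lemma tends_conj u (a : R[i]) : tends u a -> tends (fun n => (u n)^*) a^*.
Proof.
move=> h e /h[N hN]; exists N => n /hN.
by rewrite -rmorphB cmod_conj.
Qed.

Lemma tends_shift u (a : R[i]) N : tends u a -> tends (fun n => u (N + n)%N) a.
Proof.
move=> h e /h[M hM]; exists M => n Mn.
by apply: hM; rewrite (leq_trans Mn) ?leq_addl.
Qed.

Lemma eq_tends u v (a : R[i]) : u =1 v -> tends u a -> tends v a.
Proof. by move=> /funext ->. Qed.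

Lemma summ_cvg (r : nat -> R) : summ (fun k => `|r k.+1 - r k|) -> cvgn r.
Proof.
move=> [M hM].
have h : cvgn (series (fun k => r k.+1 - r k)).
  suff : cvgn (series (fun k => `|r k.+1 - r k|)) by exact: normed_cvg.
  apply: nondecreasing_is_cvgn.
    apply/nondecreasing_seqP => n; rewrite /series /= big_nat_recr //=.
    by rewrite lerDl.
  by exists M => _ [n _ <-]; rewrite /series /= big_mkord.
have -> : r = (fun n => r 0%N + series (fun k => r k.+1 - r k) n).
  by apply/funext => n; rewrite /series /= telescope_sumr // addrC subrK.
by apply: is_cvgD => //; apply: is_cvg_cst.
Qed.

Lemma bv_tends u : bv u -> exists l, tends u l.
Proof.
move=> hu.
have /summ_cvg /cvg_ex[/= a ha] : summ (fun k => `|complex.Re (u k.+1) - complex.Re (u k)|).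
  by apply: summ_le hu => k; apply: le_trans (Re_le_cmod _); rewrite raddfB.
have /summ_cvg /cvg_ex[/= b hb] : summ (fun k => `|complex.Im (u k.+1) - complex.Im (u k)|).
  by apply: summ_le hu => k; apply: le_trans (Im_le_cmod _); rewrite raddfB.
exists (a +i* b) => e e0; have e2 : 0 < e / 2 by rewrite divr_gt0.
move/cvgrPdist_lt : ha => /(_ _ e2)[N _ hN].
move/cvgrPdist_lt : hb => /(_ _ e2)[M _ hM].
exists (maxn N M) => n; rewrite geq_max => /andP[Nn Mn].
apply: le_lt_trans (cmod_le_ReIm _) _; have := hN _ Nn; have := hM _ Mn.
rewrite /= (distrC a) (distrC b); case: (u n) => c d /=; lra.
Qed.

End ComplexLimits.

Section Dichotomy.
Variable R : realType.

Lemma geometric_shift (d : nat -> R) (r : R) N c : 0 < r -> 0 < c ->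
  (forall k, d (N + k)%N <= c * r ^+ k) ->
  exists2 c', 0 < c' & forall k, d k <= c' * r ^+ k.
Proof.
move=> r0; elim: N c => [|N IH] c c0 h; first by exists c.
apply: (IH (`|d N| + c / r)) => [|k].
  by rewrite ltr_wpDl ?normr_ge0 ?divr_gt0.
case: k => [|k].
  rewrite addn0 expr0 mulr1; apply: le_trans (ler_norm _) _.
  by rewrite lerDl divr_ge0 ?ltW.
rewrite addnS -addSn; apply: le_trans (h k) _.
rewrite exprS mulrA ler_pM2r ?exprn_gt0 // mulrDl divfK ?gt_eqF //.
by rewrite lerDr mulr_ge0 ?normr_ge0 ?(ltW r0).
Qed.

Variables (x y A B C D : nat -> R[i]) (l1 l2 : R[i]).
Hypotheses (hx : forall k, x k.+1 = A k * x k + B k * y k)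
  (hy : forall k, y k.+1 = C k * x k + D k * y k)
  (hxy : forall k, ~ (x k = 0 /\ y k = 0))
  (hA : tends A l1) (hB : tends B 0) (hC : tends C 0) (hD : tends D l2)
  (bA : bv A) (bB : bv B) (bC : bv C) (bD : bv D)
  (h1 : 1 < cmod l1) (h2 : cmod l2 < 1).

(** From some rank on, the first component expands on the cone |y| <= |x| and the second
    one contracts off it; the last bound makes the ratio y / x a contraction. *)
Lemma hyperbolic_bounds : exists N q r, [/\ 1 < q, 0 < r < 1 &
  forall k, (N <= k)%N ->
    cmod (B k) + q <= cmod (A k) /\ cmod (C k) + cmod (D k) <= r /\
    cmod (B k.+1) + cmod (D k) <= r].
Proof.
pose e := Num.min ((cmod l1 - 1) / 4) ((1 - cmod l2) / 4).
have e0 : 0 < e by rewrite lt_min !divr_gt0 ?subr_gt0.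
have e1 : e <= (cmod l1 - 1) / 4 by rewrite ge_min lexx.
have e2 : e <= (1 - cmod l2) / 4 by rewrite ge_min lexx orbT.
move/(_ _ e0) : hA => [NA fA]; move/(_ _ e0) : hB => [NB fB].
move/(_ _ e0) : hC => [NC fC]; move/(_ _ e0) : hD => [ND fD].
exists (maxn (maxn NA NB) (maxn NC ND)), ((1 + cmod l1) / 2), ((1 + cmod l2) / 2).
have l20 := cmod_ge0 l2.
split; [lra|lra|].
move=> k; rewrite !geq_max => /andP[/andP[kA kB] /andP[kC kD]].
have := fA _ kA; have := fB _ kB; have := fC _ kC; have := fD _ kD.
have := fB _ (leqW kB); rewrite !subr0 => b1 d1 c1 b a1.
have := cmodD (A k) (l1 - A k); rewrite addrC subrK cmodC => a2.
have := cmodD l2 (D k - l2); rewrite addrC subrK => d2.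
by split; [lra|split; lra].
Qed.

Definition cone_ratio m k := y (m + k)%N / x (m + k)%N.

(** Once the orbit enters the cone |y| <= |x| it stays there, x grows, and y / x follows a
    contracting homography whose coefficients have bounded variation. An orbit that never
    enters the cone is dominated by its contracting component. *)
Lemma dichotomy :
  (exists c r, [/\ 0 < c, 0 < r < 1 &
     forall k, cmod (x k) + cmod (y k) <= c * r ^+ k]) \/
  (exists m, [/\ forall k, x (m + k)%N != 0, bv (cone_ratio m),
     tends (cone_ratio m) 0 &
     tends (fun k => x (m + k).+1 / x (m + k)%N) l1]).
Proof.
have [N [q [r [q1 /andP[r0 r1] hN]]]] := hyperbolic_bounds.
have [[m [Nm ym]]|nocone] :=
    pselect (exists m, (N <= m)%N /\ cmod (y m) <= cmod (x m)); last first.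
  left; have lexy k : cmod (x (N + k)%N) <= cmod (y (N + k)%N).
    apply: contrapT => /negP; rewrite -ltNge => /ltW h; apply: nocone.
    by exists (N + k)%N; rewrite leq_addr.
  have dec k : cmod (y (N + k)%N) <= cmod (y N) * r ^+ k.
    elim: k => [|k IH]; first by rewrite addn0 expr0 mulr1.
    rewrite addnS hy; apply: le_trans (cmodD _ _) _; rewrite !cmodM.
    have [_ [hr _]] := hN _ (leq_addr k N).
    apply: (@le_trans _ _ (r * cmod (y (N + k)%N))).
      apply: le_trans (ler_wpM2r (cmod_ge0 _) hr); rewrite mulrDl lerD2r.
      by rewrite ler_wpM2l ?cmod_ge0.
    by rewrite exprS mulrCA ler_pM2l.
  have c0 : 0 < 2 * cmod (y N) + 1 by have := cmod_ge0 (y N); lra.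
  have [|c c_gt0 hc] := @geometric_shift (fun k => cmod (x k) + cmod (y k)) r N _ r0 c0.
    move=> k; have := lexy k; have := dec k.
    have := exprn_ge0 k (ltW r0); rewrite mulrDl mul1r -mulrA; lra.
  by exists c, r; split; rewrite ?r0.
right; exists m.
pose t := cone_ratio m.
have cone k : x (m + k)%N != 0 /\ cmod (y (m + k)%N) <= cmod (x (m + k)%N).
  elim: k => [|k [x0 hk]].
    rewrite addn0; split => //; apply/eqP => xm; apply: (hxy (k := m)).
    by split => //; apply/eqP; rewrite -cmod_eq0 eq_le cmod_ge0 andbT -(cmod0 R) -xm.
  have [hq [hr _]] := hN _ (leq_trans Nm (leq_addr k m)).
  have xk : 0 < cmod (x (m + k)%N) by rewrite cmod_gt0.
  have hxk : cmod (x (m + k)%N) <= cmod (x (m + k).+1).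
    rewrite hx -[B _ * _]opprK; apply: le_trans (cmodB_ge _ _).
    rewrite cmodN !cmodM.
    have u1 : cmod (B (m + k)%N) * cmod (y (m + k)%N)
      <= cmod (B (m + k)%N) * cmod (x (m + k)%N) by rewrite ler_wpM2l ?cmod_ge0.
    have u2 := ler_wpM2r (ltW xk) hq.
    have u3 := ler_wpM2r (ltW xk) (ltW q1).
    rewrite mul1r in u3; rewrite mulrDl in u2; lra.
  rewrite addnS; split; first by rewrite -cmod_gt0 (lt_le_trans xk).
  apply: le_trans hxk; rewrite hy; apply: le_trans (cmodD _ _) _; rewrite !cmodM.
  have u1 : cmod (D (m + k)%N) * cmod (y (m + k)%N)
      <= cmod (D (m + k)%N) * cmod (x (m + k)%N) by rewrite ler_wpM2l ?cmod_ge0.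
  have u2 := ler_wpM2r (ltW xk) hr; have u3 := ler_wpM2r (ltW xk) (ltW r1).
  rewrite mul1r in u3; rewrite mulrDl in u2; lra.
have x0 k : x (m + k)%N != 0 by have [] := cone k.
have t1 k : cmod (t k) <= 1.
  have [_ hk] := cone k; rewrite cmodM cmodV ler_pdivrMr ?cmod_gt0 //.
  by rewrite mul1r.
pose den k := A (m + k)%N + B (m + k)%N * t k.
have hden k : q <= cmod (den k).
  have [hq _] := hN _ (leq_trans Nm (leq_addr k m)).
  rewrite /den -[B _ * _]opprK; apply: le_trans (cmodB_ge _ _).
  rewrite cmodN cmodM.
  have : cmod (B (m + k)%N) * cmod (t k) <= cmod (B (m + k)%N) * 1.
    by rewrite ler_wpM2l ?cmod_ge0.
  lra.
have den0 k : den k != 0 by rewrite -cmod_gt0; have := hden k; lra.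
have xden k : x (m + k).+1 = den k * x (m + k)%N.
  by rewrite hx /den /t /cone_ratio mulrDl -mulrA divfK.
have trec k : t k.+1 * den k = C (m + k)%N + D (m + k)%N * t k.
  rewrite /t /cone_ratio addnS hy xden.
  by move: (den0 k) (x0 k); move: (den k) => d d0 xk0; field; rewrite xk0 d0.
have bt : bv t.
  pose e k := cmod (A (m + k).+1 - A (m + k)%N) + cmod (B (m + k).+1 - B (m + k)%N)
    + (cmod (C (m + k).+1 - C (m + k)%N) + cmod (D (m + k).+1 - D (m + k)%N)).
  apply: (@summ_contraction _ _ e r); first by move=> k; exact: cmod_ge0.
  - by rewrite r1 ltW.
  - move=> k /=.
    (* the difference of two quotients, written over the later denominator *)
    have -> : t k.+2 - t k.+1 =
      (C (m + k).+1 - C (m + k)%N + (D (m + k).+1 - D (m + k)%N) * t k.+1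
        + D (m + k)%N * (t k.+1 - t k)
       - t k.+1 * (A (m + k).+1 - A (m + k)%N + (B (m + k).+1) * (t k.+1 - t k)
            + (B (m + k).+1 - B (m + k)%N) * t k)) / den k.+1.
      apply: (mulIf (den0 k.+1)); rewrite mulfVK //.
      rewrite mulrBl trec addnS.
      have -> : t k.+1 * den k.+1 = t k.+1 * den k + t k.+1 * (den k.+1 - den k) by ring.
      by rewrite trec /den addnS; ring.
    rewrite cmodM cmodV.  rewrite ler_pdivrMr ?cmod_gt0 //.
    have [_ [_ hr]] := hN _ (leq_trans Nm (leq_addr k m)).
    have := ler_wpM2r (cmod_ge0 (t k.+1 - t k)) hr.
    set dt := cmod (t k.+1 - t k) => hr'.
    have dt0 : 0 <= dt by exact: cmod_ge0.
    have e0 : 0 <= e k by rewrite /e !addr_ge0 ?cmod_ge0.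
    have re0 : 0 <= r * dt + e k by apply: addr_ge0 => //; rewrite mulr_ge0 ?(ltW r0).
    have den1 : 1 <= cmod (den k.+1) by have := hden k.+1; lra.
    apply: le_trans (_ : _ <= r * dt + e k) _; last by rewrite ler_peMr.
    apply: le_trans (cmodB _ _) _.
    have cM1 (a b : R[i]) : cmod b <= 1 -> cmod (a * b) <= cmod a.
      by move=> hb; rewrite cmodM ler_piMr ?cmod_ge0.
    rewrite [_ * (_ + _ + _)]mulrC.
    apply: le_trans (lerD (le_trans (cmodD _ _) (lerD (cmodD _ _) (lexx _)))
       (le_trans (cM1 _ _ (t1 _)) (le_trans (cmodD _ _) (lerD (cmodD _ _) (lexx _))))) _.
    rewrite (cmodM (D _)) (cmodM (B _)) -/dt /e.
    have := cM1 (D (m + k).+1 - D (m + k)%N) _ (t1 k.+1).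
    have := cM1 (B (m + k).+1 - B (m + k)%N) _ (t1 k).
    rewrite mulrDl in hr'; lra.
  - rewrite /e; apply: summD; apply: summD.
    + by move/(bv_shift A m) : bA; rewrite /bv; under eq_fun do rewrite addnS.
    + by move/(bv_shift B m) : bB; rewrite /bv; under eq_fun do rewrite addnS.
    + by move/(bv_shift C m) : bC; rewrite /bv; under eq_fun do rewrite addnS.
    + by move/(bv_shift D m) : bD; rewrite /bv; under eq_fun do rewrite addnS.
have [ts hts] := bv_tends bt.
have hden' : tends den (l1 + 0 * ts).
  exact: (tendsD (tends_shift m hA) (tendsM (tends_shift m hB) hts)).
(* the limit ts of t satisfies ts l1 = l2 ts *)
have ts0 : ts = 0.
  have L : tends (fun k => t k.+1 * den k) (ts * (l1 + 0 * ts)).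
    exact: (tendsM (tends_shift 1 hts) hden').
  have L' : tends (fun k => t k.+1 * den k) (0 + l2 * ts).
    apply: (@eq_tends _ (fun k => C (m + k)%N + D (m + k)%N * t k)).
      by move=> k; rewrite trec.
    exact: (tendsD (tends_shift m hC) (tendsM (tends_shift m hD) hts)).
  have /eqP := tends_unique L L'.
  rewrite -subr_eq0 (_ : _ - _ = ts * (l1 - l2)); last by ring.
  rewrite mulf_eq0 => /orP[/eqP//|]; rewrite subr_eq0 => /eqP l12.
  by exfalso; move: h1; rewrite l12 ltNge (ltW h2).
split => //; first by rewrite -ts0.
move: hden'; rewrite mul0r addr0; apply: eq_tends => k.
by rewrite xden mulfK.
Qed.

End Dichotomy.

Section MoreVariation.
Variable R : realType.
Implicit Types (u v : nat -> R[i]) (d : nat -> R).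

Lemma summ_progression d p j : (0 < p)%N -> (forall k, 0 <= d k) -> summ d ->
  summ (fun k => d (k * p + j)%N).
Proof.
move=> p0 d0 [M hM]; exists M => N; apply: le_trans (hM (N * p + j)%N).
elim: N => [|N IH]; first by rewrite big_ord0 sumr_ge0.
rewrite big_ord_recr /=.
have -> : (N.+1 * p + j = (N * p + j).+1 + p.-1)%N.
  by rewrite mulSn; lia.
rewrite big_split_ord /= [X in _ <= X + _]big_ord_recr /=.
by rewrite (le_trans (lerD IH (lexx _))) // lerDl sumr_ge0.
Qed.

Lemma summ_of_progressions d p : (0 < p)%N -> (forall k, 0 <= d k) ->
  (forall j, (j < p)%N -> summ (fun k => d (k * p + j)%N)) -> summ d.
Proof.
move=> p0 d0 hd.
have [M hM] : exists M, forall N, \sum_(j < p) \sum_(k < N) d (k * p + j)%N <= M.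
  suff : forall J, (J <= p)%N ->
    exists M, forall N, \sum_(j < J) \sum_(k < N) d (k * p + j)%N <= M by exact.
  elim=> [|J IH] Jp; first by exists 0 => N; rewrite big_ord0.
  have [M hM] := IH (ltnW Jp); have [M' hM'] := hd _ Jp.
  by exists (M + M') => N; rewrite big_ord_recr lerD.
exists M => N; apply: le_trans (hM N).
apply: (@le_trans _ _ (\sum_(k < N * p) d k)).
  have -> : (N * p = N + (N * p - N))%N by rewrite subnKC // leq_pmulr.
  by rewrite big_split_ord /= lerDl sumr_ge0.
elim: N => [|N IH]; first by rewrite big_ord0 sumr_ge0 // => j _; rewrite sumr_ge0.
rewrite mulSn addnC big_split_ord /=.
apply: le_trans (lerD IH (lexx _)) _; rewrite -big_split /=.
by apply: ler_sum => j _; rewrite big_ord_recr.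
Qed.

Lemma summ_geometric (r c : R) : 0 < r < 1 -> summ (fun k => c * r ^+ k).
Proof.
move=> /andP[r0 r1]; exists (`|c| / (1 - r)) => n.
apply: (@le_trans _ _ (\sum_(k < n) `|c| * r ^+ k)).
  by apply: ler_sum => k _; rewrite ler_wpM2r ?ler_norm // exprn_ge0 // ltW.
rewrite -mulr_sumr ler_wpM2l // -[X in _ <= X]mul1r ler_pdivlMr ?subr_gt0 //.
have := subrX1 r n; have := exprn_ge0 n (ltW r0); lra.
Qed.

Lemma not_summ_lower_bound d (c : R) : 0 < c -> (forall k, c <= d k) -> ~ summ d.
Proof.
move=> c0 hd [M hM].
have := hM (Num.bound `|M / c|).
apply/negP; rewrite -ltNge; apply: (@lt_le_trans _ _ (\sum_(k < Num.bound `|M / c|) c)).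
  rewrite sumr_const card_ord -mulr_natl -ltr_pdivrMr //.
  by apply: le_lt_trans (ler_norm _) _; exact: archi_boundP (normr_ge0 _).
by apply: ler_sum => k _.
Qed.

Lemma eventually_uniform_lt1 (g : nat -> R) N A : A < 1 -> (forall k, g k < 1) ->
  (forall k, (N <= k)%N -> g k <= A) -> exists2 A', A' < 1 & forall k, g k <= A'.
Proof.
elim: N A => [|N IH] A A1 g1 hA; first by exists A => // k; exact: hA.
apply: (IH (Num.max A (g N))); rewrite ?gt_max ?A1 ?g1 //.
move=> k; rewrite leq_eqVlt => /orP[/eqP <-|/hA h]; rewrite le_max ?lexx ?orbT //.
by rewrite h.
Qed.

Lemma tends_uniform_lt1 u l : (forall k, cmod (u k) < 1) -> cmod l < 1 -> tends u l ->
  exists2 A, A < 1 & forall k, cmod (u k) <= A.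
Proof.
move=> u1 l1 /(_ ((1 - cmod l) / 2)) []; first by rewrite divr_gt0 ?subr_gt0.
move=> N hN; apply: (eventually_uniform_lt1 (A := (1 + cmod l) / 2) (N := N)) => //.
  lra.
move=> k /hN; have := cmodD (u k - l) l; rewrite subrK; lra.
Qed.

(** A square root that stays away from 0 inherits bounded variation from its
    square, since (u' - u) (u' + u) = u'^2 - u^2. *)
Lemma bv_sqrt (g : nat -> R) c : 0 < c -> (forall k, c <= g k) ->
  bv (fun k => (g k)%:C ^+ 2) -> bv (fun k => (g k)%:C).
Proof.
move=> c0 gc; have c1 : 0 <= c^-1 by rewrite invr_ge0 ltW.
move=> h; apply: summ_le (summZ c1 h) => k.
rewrite ler_pdivlMl // subr_sqr cmodM mulrC ler_wpM2l ?cmod_ge0 //.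
rewrite -rmorphD cmod_real; apply: le_trans (ler_norm _).
by have := gc k; have := gc k.+1; lra.
Qed.

Lemma tends_sqrt (g : nat -> R) (l : R) : 0 < l -> (forall k, 0 <= g k) ->
  tends (fun k => (g k)%:C ^+ 2) (l%:C ^+ 2) -> tends (fun k => (g k)%:C) l%:C.
Proof.
move=> l0 g0 h e e0; have [|N hN] := h (e * l); first by rewrite mulr_gt0.
exists N => k /hN; rewrite subr_sqr cmodM -rmorphD (cmod_real (_ + _)).
rewrite ger0_norm ?addr_ge0 ?(ltW l0) // => hk; rewrite -(ltr_pM2r l0).
by apply: le_lt_trans hk; rewrite ler_wpM2l ?cmod_ge0 // lerDr.
Qed.

(** Successive differences of S contract up to the variation of the coefficients, so
    [summ_contraction] applies. *)
Lemma bv_affine (S B G : nat -> R[i]) kappa N : (forall k, S k.+1 = B k + G k * S k) ->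
  bv B -> bv G -> kappa < 1 -> (forall k, (N <= k)%N -> cmod (G k) <= kappa) -> bv S.
Proof.
move=> rec hB hG k1 hk; apply/(bv_shift S N).
have [M M0 hM] := bv_bounded hB.
have k0 : 0 <= kappa by apply: le_trans (hk _ (leqnn _)); exact: cmod_ge0.
(* an invariant bound: M + kappa L <= L *)
pose L := cmod (S N) + M / (1 - kappa).
have k1' : 0 < 1 - kappa by rewrite subr_gt0.
have ML : M <= L * (1 - kappa).
  by rewrite mulrDl divfK ?gt_eqF // lerDr mulr_ge0 ?cmod_ge0 // ltW.
have L0 : 0 <= L by rewrite addr_ge0 ?cmod_ge0 // divr_ge0 // ltW.
have SL k : cmod (S (N + k)%N) <= L.
  elim: k => [|k IH]; first by rewrite addn0 lerDl divr_ge0 // ltW.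
  rewrite addnS rec; apply: le_trans (cmodD _ _) _; rewrite cmodM.
  have := hM (N + k)%N; have := ler_pM (cmod_ge0 _) (cmod_ge0 _) (hk _ (leq_addr k N)) IH.
  rewrite mulrBr mulr1 in ML; lra.
pose e k := cmod (B (N + k.+1)%N - B (N + k)%N) + L * cmod (G (N + k.+1)%N - G (N + k)%N).
apply: (@summ_contraction _ _ e kappa); [by move=> k; exact: cmod_ge0|by rewrite k0| |].
  move=> k; rewrite /e.
  have -> : S (N + k.+2)%N - S (N + k.+1)%N = B (N + k.+1)%N - B (N + k)%N
     + (G (N + k.+1)%N - G (N + k)%N) * S (N + k)%N
     + G (N + k.+1)%N * (S (N + k.+1)%N - S (N + k)%N).
    by rewrite !addnS !rec; ring.
  apply: le_trans (cmodD _ _) _; rewrite cmodM.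
  have := ler_wpM2r (cmod_ge0 (S (N + k.+1)%N - S (N + k)%N)) (hk _ (leq_addr k.+1 N)).
  have := cmodD (B (N + k.+1)%N - B (N + k)%N) ((G (N + k.+1)%N - G (N + k)%N) * S (N + k)%N).
  rewrite cmodM.
  have := ler_wpM2l (cmod_ge0 (G (N + k.+1)%N - G (N + k)%N)) (SL k).
  rewrite (mulrC _ L); lra.
apply: summD; first by apply/(bv_shift B N).
by apply: summZ => //; apply/(bv_shift G N).
Qed.

End MoreVariation.

(** * Transfer matrices as elements of SU(1,1) *)

Section Expi.
Variable R : realType.
Implicit Types t u : R.

Lemma expiD t u : expi (t + u) = expi t * expi u :> R[i].
Proof. by rewrite /expi cosD sinD; simpc; congr (_ +i* _); rewrite addrC. Qed.

Lemma cmod_expi t : cmod (expi t) = 1.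
Proof. by rewrite /= cos2Dsin2 sqrtr1. Qed.

Lemma expiJ t : expi t * (expi t)^* = 1 :> R[i].
Proof. by rewrite -sqr_cmod cmod_expi expr1n. Qed.

Lemma expi_half t : expi (t / 2) ^+ 2 = expi t :> R[i].
Proof. by rewrite expr2 -expiD -splitr. Qed.

Lemma expi_2pi t : expi (t + 2 * pi) = expi t :> R[i].
Proof. by rewrite /expi mulr_natl cosD2pi sinD2pi. Qed.

Lemma unimodular_expi (z : R[i]) : `|z| == 1 -> exists t, z = expi t.
Proof.
case: z => a b; rewrite normE -[1]/(1%:C) => /eqP/complexI ab.
have ab1 : a ^+ 2 + b ^+ 2 = 1 by rewrite -[RHS](expr1n _ 2) -ab sqr_sqrtr ?addr_ge0 ?sqr_ge0.
have a1 : -1 <= a <= 1 by have := sqr_ge0 b; nra.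
have sb : sin (acos a) = `|b|.
  by rewrite sin_acos // -ab1 addrAC subrr add0r sqrtr_sqr.
have [b0|b0] := leP 0 b.
  by exists (acos a); rewrite /expi acosK // sb ger0_norm.
by exists (- acos a); rewrite /expi cosN sinN acosK // sb ltr0_norm // opprK.
Qed.

End Expi.

Section TransferCoefficients.
Variable R : realType.
Implicit Types (al : nat -> R[i]) (s : R[i]).

Definition rho al n : R[i] := (Num.sqrt (1 - cmod (al n) ^+ 2))%:C.

(** With z = s^2, the n-step transfer matrix is s^n times the matrix ((a, b), (conj b,
    conj a)) of the map F |-> a F + b conj F ([transfer_mxE]). The square root s of z is
    what makes this symmetric form possible. *)
Fixpoint tcoef al s n : R[i] * R[i] :=
  if n is m.+1 then
    let: (a, b) := tcoef al s m in
    ((rho al m)^-1 * (s * a - (al m)^* * s^* * b^*),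
     (rho al m)^-1 * (s * b - (al m)^* * s^* * a^*))
  else (1, 0).

Definition ta al s n := (tcoef al s n).1.
Definition tb al s n := (tcoef al s n).2.

Lemma ta0 al s : ta al s 0 = 1. Proof. by []. Qed.

Lemma tb0 al s : tb al s 0 = 0. Proof. by []. Qed.

Lemma taS al s n : ta al s n.+1 =
  (rho al n)^-1 * (s * ta al s n - (al n)^* * s^* * (tb al s n)^*).
Proof. by rewrite /ta /tb /=; case: (tcoef al s n). Qed.

Lemma tbS al s n : tb al s n.+1 =
  (rho al n)^-1 * (s * tb al s n - (al n)^* * s^* * (ta al s n)^*).
Proof. by rewrite /ta /tb /=; case: (tcoef al s n). Qed.

Lemma sqr_rho al n : cmod (al n) < 1 -> rho al n ^+ 2 = 1 - al n * (al n)^*.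
Proof.
move=> h; rewrite /rho -rmorphXn /= sqr_sqrtr; last first.
  by rewrite subr_ge0 expr_le1 ?cmod_ge0 // ltW.
by rewrite rmorphB rmorph1 /= -sqr_cmod.
Qed.

Lemma rho_neq0 al n : cmod (al n) < 1 -> rho al n != 0.
Proof.
move=> h; rewrite -cmod_gt0 cmod_real normr_gt0 sqrtr_eq0 -ltNge.
by rewrite subr_gt0 expr_lt1 ?cmod_ge0.
Qed.

Lemma conj_rho al n : (rho al n)^* = rho al n.
Proof. exact: conjc_real. Qed.

Section Fixed.
Variables (al : nat -> R[i]) (s : R[i]).
Hypotheses (hal : forall n, cmod (al n) < 1) (hs : s * s^* = 1).

(** The transfer matrices lie in SU(1,1) up to the factor s^n. *)
Lemma tcoef_det n :
  ta al s n * (ta al s n)^* - tb al s n * (tb al s n)^* = 1.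
Proof.
elim: n => [|n IH]; first by rewrite ta0 tb0 conjC0 conjC1 mulr0 mulr1 subr0.
rewrite taS tbS !rmorphM !rmorphB !rmorphM /= !conjCK !fmorphV /= conj_rho.
have r0 := rho_neq0 (hal n); have r2 := sqr_rho (hal n).
move: IH hs r0 r2; move: (ta _ _ _) (tb _ _ _) (rho _ _) (al n) => a b r z.
move: (a^*) (b^*) (z^*) (s^*) => a' b' z' s' IH hs' r0 r2.
apply: (mulIf (expf_neq0 2 r0)); rewrite mul1r [RHS]r2.
transitivity (s * s' * (1 - z * z') * (a * a' - b * b')).
  have -> : forall u u' v v', (r^-1 * u * (r^-1 * u') - r^-1 * v * (r^-1 * v')) * r ^+ 2
     = u * u' - v * v' by move=> ? ? ? ?; field.
  ring.
by rewrite hs' IH mul1r mulr1.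
Qed.

Lemma transfer_mxE n : transfer_mx al n (s ^+ 2) =
  s ^+ n *: \matrix_(i, j) (if i == 0 then if j == 0 then ta al s n else tb al s n
    else if j == 0 then (tb al s n)^* else (ta al s n)^*).
Proof.
elim: n => [|n IH].
  rewrite expr0 scale1r; apply/matrixP => i j; rewrite !mxE ta0 tb0 conjC0 conjC1.
  by case: i => [[|[|[]]]] // ?; case: j => [[|[|[]]]].
rewrite /= IH; apply/matrixP => i j; rewrite !mxE big_ord_recl big_ord1 !mxE /=.
rewrite taS tbS !rmorphM !rmorphB !rmorphM /= !conjCK !fmorphV /= conj_rho -/(rho al n).
have r0 := rho_neq0 (hal n).
move: hs r0; move: (ta _ _ _) (tb _ _ _) (rho _ _) (al n) => a b r z.
have s0 : s != 0 by apply: contra_eq_neq hs => ->; rewrite mul0r eq_sym oner_eq0.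
have -> : s^* = s^-1 by apply: (mulfI s0); rewrite hs divff.
move=> _ r0; rewrite expr2 exprS; move: (s ^+ n) (a^*) (b^*) (z^*) => sn a' b' z'.
by case: i => [[|[|[]]]] // ?; case: j => [[|[|[]]]] // ? /=; field; rewrite s0 r0.
Qed.

Lemma cmod_trace_transfer n : cmod s = 1 ->
  cmod (\tr (transfer_mx al n (s ^+ 2))) = 2 * `|complex.Re (ta al s n)|.
Proof.
move=> s1; rewrite transfer_mxE mxtraceZ cmodM cmodX s1 expr1n mul1r.
rewrite /mxtrace big_ord_recl big_ord1 !mxE /= [X in cmod X]addcJ cmodM cmod_real.
by rewrite -[2 in LHS](rmorph_nat (real_complex R)) cmod_real normr_nat.
Qed.

End Fixed.
End TransferCoefficients.

(** * Differentiation along the circle *)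

Section ComplexDerivative.
Variable R : realType.
Implicit Types (f g : R -> R[i]) (t : R).

Definition cderiv f t (d : R[i]) :=
  is_derive t (1 : R) (fun u => complex.Re (f u)) (complex.Re d) /\
  is_derive t (1 : R) (fun u => complex.Im (f u)) (complex.Im d).

Lemma cderiv_eq f g t d e : f =1 g -> d = e -> cderiv f t d -> cderiv g t e.
Proof. by move=> /funext -> ->. Qed.

Lemma cderiv_cst c t : cderiv (fun=> c) t 0.
Proof. by split; exact: is_derive_cst. Qed.

Lemma cderivD f g t df dg : cderiv f t df -> cderiv g t dg ->
  cderiv (fun u => f u + g u) t (df + dg).
Proof.
move=> [f1 f2] [g1 g2]; rewrite /cderiv !(ReD, ImD); split.
  under eq_fun do rewrite ReD; exact: is_deriveD.
under eq_fun do rewrite ImD; exact: is_deriveD.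
Qed.

Lemma cderivM f g t df dg : cderiv f t df -> cderiv g t dg ->
  cderiv (fun u => f u * g u) t (df * g t + f t * dg).
Proof.
move=> [f1 f2] [g1 g2]; rewrite /cderiv; split.
  under eq_fun do rewrite Re_mul.
  apply: (is_derive_eq (is_deriveB (is_deriveM f1 g1) (is_deriveM f2 g2))).
  by rewrite ReD !Re_mul /GRing.scale /=; ring.
under eq_fun do rewrite Im_mul.
apply: (is_derive_eq (is_deriveD (is_deriveM f1 g2) (is_deriveM f2 g1))).
by rewrite ImD !Im_mul /GRing.scale /=; ring.
Qed.

Lemma cderivZ c f t df : cderiv f t df -> cderiv (fun u => c * f u) t (c * df).
Proof.
by move=> hf; apply: cderiv_eq (cderivM (cderiv_cst c t) hf) => //; rewrite mul0r add0r.
Qed.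

Lemma cderiv_conj f t df : cderiv f t df -> cderiv (fun u => (f u)^*) t df^*.
Proof.
move=> [f1 f2]; split.
  by under eq_fun do rewrite Re_conj; rewrite Re_conj.
by under eq_fun do rewrite Im_conj; rewrite Im_conj; exact: is_deriveN.
Qed.

(** i/2, the logarithmic derivative of expi (t / 2). *)
Definition ihalf : R[i] := 0 +i* 2^-1.

Lemma conj_ihalf : ihalf^* = - ihalf.
Proof. by rewrite /ihalf; apply/eqP; rewrite eq_complex /= oppr0 !eqxx. Qed.

Lemma cderiv_expi_half t : cderiv (fun u => expi (u / 2)) t (ihalf * expi (t / 2)).
Proof.
have h : is_derive t (1 : R) (fun u : R => u / 2) 2^-1.
  have := @is_deriveM R R id (cst 2^-1) t 1 1 0 _ _.
  rewrite /GRing.scale /= mulr0 add0r mulr1; exact.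
split; rewrite /expi /ihalf /=.
  apply: (is_derive_eq (@is_derive1_comp _ cos (fun u => u / 2) _ _ _ (is_derive_cos _) h)).
  by ring.
apply: (is_derive_eq (@is_derive1_comp _ sin (fun u => u / 2) _ _ _ (is_derive_sin _) h)).
by ring.
Qed.

End ComplexDerivative.

Section RealAnalysis.
Variable R : realType.
Implicit Types (f g y u v : R -> R).

Lemma is_derive_unique f t d e :
  is_derive t (1 : R) f d -> is_derive t (1 : R) f e -> d = e.
Proof. by move=> h1 h2; rewrite -(@derive_val _ _ _ _ _ _ _ h1) (@derive_val _ _ _ _ _ _ _ h2). Qed.

(** Compare the difference quotients and let the increment tend to 0. *)
Lemma sqr_derive_le y u v t dy du dv (d : R) : 0 < d ->
  is_derive t (1 : R) y dy -> is_derive t (1 : R) u du -> is_derive t (1 : R) v dv ->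
  y t = 0 -> u t = 0 -> v t = 0 ->
  (forall s, `|s - t| < d -> y s ^+ 2 <= u s ^+ 2 + v s ^+ 2) ->
  dy ^+ 2 <= du ^+ 2 + dv ^+ 2.
Proof.
move=> d0 hy hu hv y0 u0 v0 le.
have L f df : is_derive t (1 : R) f df -> f t = 0 ->
    (fun h : R => (h^-1 * f (h + t)) ^+ 2) h @[h --> 0^'] --> df ^+ 2.
  move=> [/cvg_ex[/= l hl] <-] f0.
  have := cvg_lim (@norm_hausdorff _ _) hl; rewrite /derive => ->.
  have : (fun h : R => h^-1 * f (h + t)) h @[h --> 0^'] --> l.
    move: hl; rewrite /GRing.scale /= f0.
    by under eq_fun do rewrite subr0 mulr1.
  by move=> h; exact: (cvgM h h).
have Ly := L _ _ hy y0; have Luv := cvgD (L _ _ hu u0) (L _ _ hv v0).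
apply: (@ler_cvg_to R (0 : R)^' _ R _ _ _ _ Ly (Luv _)).
near=> h.
rewrite -[leRHS]/((h^-1 * u (h + t)) ^+ 2 + (h^-1 * v (h + t)) ^+ 2).
rewrite !exprMn -mulrDr ler_wpM2l ?sqr_ge0 //; apply: le.
rewrite addrK; near: h.
by exists d => // h; rewrite /ball_ /= sub0r normrN.
Unshelve. all: by end_near.
Qed.

(** The supremum of {f >= 1} below t; the value there is 1 by the intermediate value
    theorem. *)
Lemma last_exit f c t : continuous f -> c <= t -> 1 <= f c -> f t < 1 ->
  exists a, [/\ c <= a, a < t, f a = 1 & forall s, a < s <= t -> f s < 1].
Proof.
move=> fc ct c1 t1; pose A := [set s | s <= t /\ 1 <= f s].
have A0 : A !=set0 by exists c.
have Aub : has_ubound A by exists t => s [].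
have Acl : closed A.
  have -> : A = [set s | s <= t] `&` f @^-1` [set s | 1 <= s] by [].
  apply: closedI; first exact: closed_le.
  by apply: closed_comp => [s _|]; [exact: fc|exact: closed_ge].
have [st s1] : A (sup A) by apply: Acl; exact: closure_sup.
have [w wI fw] : exists2 w, w \in `[sup A, t] & f w = 1.
  apply: IVT => //; first exact: continuous_subspaceT.
  by rewrite ge_min le_max s1 (ltW t1) orbT.
have [sw wt] : sup A <= w /\ w <= t by move: wI; rewrite in_itv => /andP[].
have ws : w <= sup A by apply: ub_le_sup => //; split; rewrite ?fw.
have wE : w = sup A by apply/eqP; rewrite eq_le ws sw.
rewrite -wE in st s1; exists w; split => //.
- by rewrite wE; apply: ub_le_sup.
- by rewrite lt_neqAle st andbT; apply: contraTneq t1 => <-; rewrite fw ltxx.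
- move=> s /andP[ws' s_t]; rewrite ltNge; apply/negP => fs1.
  have : s <= sup A by apply: ub_le_sup.
  by rewrite -wE leNgt ws'.
Qed.

Lemma first_exit f c t : continuous f -> t <= c -> 1 <= f c -> f t < 1 ->
  exists b, [/\ b <= c, t < b, f b = 1 & forall s, t <= s < b -> f s < 1].
Proof.
move=> fc tc c1 t1; pose g s := f (- s).
have gc : continuous g.
  by move=> s; apply: continuous_comp; [exact: opp_continuous|exact: fc].
have [|||a [ca at_ ga hs]] := last_exit (c := - c) (t := - t) gc.
- by rewrite lerN2.
- by rewrite /g opprK.
- by rewrite /g opprK.
exists (- a); split => //; first by rewrite lerNl.
- by rewrite ltrNr.
- move=> s /andP[ts sa]; rewrite -[s]opprK; apply: (hs (- s)).
  by rewrite ltrNr sa lerN2 ts.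
Qed.

End RealAnalysis.

(** * Off the bands the transfer matrix is hyperbolic *)

Section Bands.
Variables (R : realType) (beta : nat -> R[i]).
Hypothesis hbeta : forall n, cmod (beta n) < 1.

Local Definition coef_a n (t : R) := ta beta (expi (t / 2)) n.
Local Definition coef_b n (t : R) := tb beta (expi (t / 2)) n.

(** The derivative of the transfer matrix M_n is M_n (i/2) J P, where J = diag (1, -1) and
    P is the sum over m < n of the positive matrices (adjoint of M_m) M_m. The numbers r
    and q are the diagonal and off-diagonal entries of P; its positive definiteness is |q|
    < r. *)
Lemma tcoef_cderiv n t : exists (r : R) (q : R[i]),
  [/\ cmod q <= r, (0 < n)%N -> cmod q < r,
      cderiv (coef_a n) t (ihalf R * (coef_a n t * r%:C - coef_b n t * q^*)) &
      cderiv (coef_b n) t (ihalf R * (coef_a n t * q - coef_b n t * r%:C))].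
Proof.
elim: n => [|n [r [q [qr _ da db]]]].
  exists 0, 0; split; rewrite ?cmod0 //.
    apply: cderiv_eq (cderiv_cst 1 t) => //.
    by rewrite rmorph0 conjC0 !mulr0 subr0 mulr0.
  apply: cderiv_eq (cderiv_cst 0 t) => //.
  by rewrite rmorph0 !mulr0 subr0 mulr0.
have det : coef_a n t * (coef_a n t)^* - coef_b n t * (coef_b n t)^* = 1.
  exact: (tcoef_det hbeta (expiJ _)).
pose r' := r + (cmod (coef_a n t) ^+ 2 + cmod (coef_b n t) ^+ 2).
pose q' := q + 2 * ((coef_a n t)^* * coef_b n t).
have q'r' : cmod q' < r'.
  apply: le_lt_trans (cmodD _ _) _; rewrite !cmodM cmod_conj.
  rewrite (_ : cmod 2 = 2); last by rewrite -[2 in LHS](rmorph_nat (real_complex R)) cmod_real normr_nat.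
  have : 0 < (cmod (coef_a n t) - cmod (coef_b n t)) ^+ 2.
    rewrite exprn_even_gt0 //= subr_eq0; apply: contra_eq_neq det => ab.
    by rewrite -!sqr_cmod ab subrr eq_sym oner_eq0.
  rewrite /r'; nra.
have r'E : r'%:C = r%:C + coef_a n t * (coef_a n t)^* + coef_b n t * (coef_b n t)^*.
  by rewrite !rmorphD /= !sqr_cmod addrA.
have q'J : q'^* = q^* + 2 * (coef_a n t * (coef_b n t)^*).
  by rewrite rmorphD !rmorphM /= conjCK rmorph_nat.
exists r', q'; split; [exact: ltW|by []| |].
  apply: cderiv_eq (cderivZ (rho beta n)^-1 (cderivD (cderivM (cderiv_expi_half t) da)
    (cderivZ (- (beta n)^*) (cderivM (cderiv_conj (cderiv_expi_half t)) (cderiv_conj db))))).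
    by move=> u; rewrite /coef_a taS mulNr mulrA.
  rewrite r'E q'J /coef_a /coef_b taS tbS -/(coef_a n t) -/(coef_b n t).
  rewrite !(rmorphM, rmorphB) /= conj_ihalf conjc_realJ.
  move: det; clear r'E q'J q'r' r' q' qr da db; move: (coef_a n t) (coef_b n t) (expi _) (beta n) q (rho _ _)^-1 (ihalf R) r%:C.
  move=> A B S Z Q P I r0.
  move: A^* B^* S^* Z^* Q^* => A' B' S' Z' Q' det.
  transitivity (P * (I * S * A * (A * A' - B * B') + S * (I * (A * r0 - B * Q')) +
    - Z' * (- I * S' * B' * (A * A' - B * B') + S' * (- I * (A' * Q' - B' * r0))))).
    by rewrite det !mulr1.
  ring.
apply: cderiv_eq (cderivZ (rho beta n)^-1 (cderivD (cderivM (cderiv_expi_half t) db)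
    (cderivZ (- (beta n)^*) (cderivM (cderiv_conj (cderiv_expi_half t)) (cderiv_conj da))))).
  by move=> u; rewrite /coef_b tbS mulNr mulrA.
rewrite r'E /q' /coef_a /coef_b taS tbS -/(coef_a n t) -/(coef_b n t).
rewrite !(rmorphM, rmorphB) /= conj_ihalf conjc_realJ conjCK.
move: det; clear r'E q'J q'r' r' q' qr da db; move: (coef_a n t) (coef_b n t) (expi _) (beta n) q (rho _ _)^-1 (ihalf R) r%:C.
move=> A B S Z Q P I r0.
move: A^* B^* S^* Z^* Q^* => A' B' S' Z' Q' det.
transitivity (P * (I * S * B * (A * A' - B * B') + S * (I * (A * Q - B * r0)) +
    - Z' * (- I * S' * A' * (A * A' - B * B') + S' * (- I * (A' * r0 - B' * Q))))).
  by rewrite det !mulr1.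
ring.
Qed.

Variable n : nat.
Hypothesis n0 : (0 < n)%N.

(** Half of the discriminant s^-n Tr T_n = a + conj a. *)
Local Definition disc t := complex.Re (coef_a n t).

Lemma sqr_cmod_tcoef t : disc t ^+ 2 + complex.Im (coef_a n t) ^+ 2 = 1 + cmod (coef_b n t) ^+ 2.
Proof.
have : (cmod (coef_a n t) ^+ 2 - cmod (coef_b n t) ^+ 2)%:C = 1%:C.
  by rewrite rmorphB /= !sqr_cmod rmorph1; exact: (tcoef_det hbeta (expiJ (t / 2)) n).
by move/complexI; rewrite (sqr_cmodE (coef_a n t)) /disc; lra.
Qed.

Lemma Re_ihalf z : complex.Re (ihalf R * z) = - (2^-1 * complex.Im z).
Proof. by rewrite Re_mul /= mul0r sub0r. Qed.

Lemma Im_ihalf z : complex.Im (ihalf R * z) = 2^-1 * complex.Re z.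
Proof. by rewrite Im_mul /= mul0r add0r. Qed.

(** On {|disc| <= 1} one has |b| <= |Im a|, so |q| < r leaves a critical point no room
    unless Im a = b = 0, that is, unless the transfer matrix is central. *)
Lemma critical_central t : `|disc t| <= 1 -> is_derive t (1 : R) disc 0 ->
  complex.Im (coef_a n t) = 0 /\ coef_b n t = 0.
Proof.
move=> x1 d0; have [r [q [_ /(_ n0) qr [da _] _]]] := tcoef_cderiv n t.
have := is_derive_unique da d0; rewrite Re_ihalf.
have -> : complex.Im (coef_a n t * r%:C - coef_b n t * q^*) =
    complex.Im (coef_a n t) * r - complex.Im (coef_b n t * q^*).
  have ImB (z z' : R[i]) : complex.Im (z - z') = complex.Im z - complex.Im z'.
    by case: z z' => [? ?] [].
  by rewrite ImB (Im_mul (coef_a n t)) mulr0 add0r.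
move=> /eqP; rewrite oppr_eq0 mulf_eq0 invr_eq0 pnatr_eq0 /= subr_eq0 => /eqP yr.
have x2 : disc t ^+ 2 <= 1 by rewrite -[1](expr1n _ 2) -real_normK ?num_real // lerXn2r ?nnegrE.
have by2 : cmod (coef_b n t) <= `|complex.Im (coef_a n t)|.
  rewrite -ler_sqr ?nnegrE ?cmod_ge0 ?normr_ge0 // real_normK ?num_real //.
  have := sqr_cmod_tcoef t; lra.
have r0 : 0 < r by apply: le_lt_trans qr; exact: cmod_ge0.
have : `|complex.Im (coef_a n t)| * r <= `|complex.Im (coef_a n t)| * cmod q.
  rewrite -{1}(gtr0_norm r0) -normrM yr; apply: le_trans (Im_le_cmod _) _.
  by rewrite cmodM cmod_conj ler_wpM2r ?cmod_ge0.
have [y0|] := eqVneq (complex.Im (coef_a n t)) 0.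
  move: by2; rewrite y0 normr0 => b0 _; split => //; apply/eqP.
  by rewrite -cmod_eq0 eq_le b0 cmod_ge0.
by rewrite -normr_gt0 => y0; rewrite ler_pM2l // leNgt qr.
Qed.

Lemma derivable_disc t : derivable disc t 1.
Proof. by have [r [q [_ _ [[]]]]] := tcoef_cderiv n t. Qed.

Lemma continuous_disc : continuous disc.
Proof.
by move=> t; apply/differentiable_continuous/derivable1_diffP/derivable_disc.
Qed.

(** If disc^2 >= 1 near t, then t is a local minimum of disc^2 with value 1 and the
    transfer matrix is central there; but 1 - disc^2 = (Im a)^2 - |b|^2 is positive to
    second order near such a point, again by |q| < r. *)
Lemma elliptic_dense t d : `|disc t| <= 1 -> 0 < d ->
  exists s, `|s - t| < d /\ `|disc s| < 1.
Proof.
move=> x1 d0; apply: contrapT => /forallNP none.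
have ge1 s : `|s - t| < d -> 1 <= `|disc s|.
  by move=> sd; rewrite leNgt; apply/negP => s1; apply: (none s).
have sqge1 s : `|s - t| < d -> 1 <= disc s ^+ 2.
  by move=> /ge1 h; rewrite -real_normK ?num_real // exprn_ege1.
have tt : `|t - t| < d by rewrite subrr normr0.
have xt1 : disc t ^+ 2 = 1.
  apply/eqP; rewrite eq_le sqge1 // andbT -real_normK ?num_real //.
  by rewrite -[1](expr1n _ 2) lerXn2r ?nnegrE.
have dd := @derivable_disc t.
have crit : is_derive t (1 : R) disc 0.
  have dx : is_derive t (1 : R) disc ('D_1 disc t) by apply/derivableP.
  have dsq u : is_derive u (1 : R) (- (disc ^+ 2)) (- ((2%:R * disc u ^+ 1) *: 'D_1 disc u)).
    have du : is_derive u (1 : R) disc ('D_1 disc u).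
      by apply/derivableP; exact: derivable_disc.
    exact: (is_deriveN (is_deriveX 2 du)).
  have sqE u : (- (disc ^+ 2)) u = - (disc u ^+ 2) by [].
  have h : is_derive t (1 : R) (- (disc ^+ 2)) 0.
    apply: (@derive1_at_max _ _ (t - d) (t + d)).
    - lra.
    - by move=> u _; exact: (@ex_derive _ _ _ _ _ _ _ (dsq u)).
    - by rewrite in_itv /=; apply/andP; split; lra.
    - move=> u; rewrite in_itv /= => /andP[s1 s2]; rewrite !sqE lerN2 xt1 sqge1 //.
      by rewrite ltr_norml; apply/andP; split; lra.
  have := is_derive_unique (dsq t) h.
  rewrite expr1 /GRing.scale /= => /eqP; rewrite oppr_eq0 !mulf_eq0 pnatr_eq0 /=.
  have -> /= : (disc t == 0) = false.
    by apply/negbTE; rewrite -(sqrf_eq0 (disc t)) xt1 oner_eq0.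
  by move/eqP => <-.
have [y0 b0] := critical_central x1 crit.
have [r [q [_ /(_ n0) qr [_ dy] [du dv]]]] := tcoef_cderiv n t.
have := sqr_derive_le d0 dy du dv y0.
rewrite b0 => /(_ erefl erefl); rewrite !mul0r !subr0.
have -> : complex.Im (ihalf R * (coef_a n t * r%:C)) = 2^-1 * (disc t * r).
  by rewrite Im_ihalf Re_mul /= mulr0 subr0.
have -> : ihalf R * (coef_a n t * q) = ihalf R * ((disc t)%:C * q).
  by rewrite {1}[coef_a n t]complexE y0 rmorph0 mulr0 addr0.
rewrite -sqr_cmodE !exprMn xt1 !cmodM cmod_real !exprMn real_normK ?num_real // xt1.
have -> : cmod (ihalf R) ^+ 2 = 2^-1 ^+ 2 by rewrite sqr_cmodE /= expr0n add0r.
rewrite !mul1r ler_pM2l ?exprn_gt0 ?invr_gt0 ?ltr0n //.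
have r0 : 0 <= r by apply: le_trans (cmod_ge0 _) (ltW qr).
rewrite ler_sqr ?nnegrE ?cmod_ge0 // leNgt qr => contra.
have // : false; apply: contra => s /sqge1; rewrite -sqr_cmodE.
have := sqr_cmod_tcoef s; lra.
Qed.

(** The period is 4 pi and not 2 pi because of the square root s. *)
Lemma disc_period t : disc (t + 4 * pi) = disc t.
Proof.
rewrite /disc /coef_a (_ : (t + 4 * pi) / 2 = t / 2 + 2 * pi); last by field.
by rewrite expi_2pi.
Qed.

(** Rolle on a period gives a critical point of disc, which cannot be elliptic. *)
Lemma nonelliptic_between t : exists c, [/\ t < c, c < t + 4 * pi & 1 <= `|disc c|].
Proof.
have t4 : t < t + 4 * pi by rewrite ltrDl mulr_gt0 ?pi_gt0.
have [c ci dc] : exists2 c, c \in `]t, (t + 4 * pi)[%R & is_derive c (1 : R) disc 0.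
  apply: Rolle => //; first by move=> s _; exact: derivable_disc.
    by apply: continuous_subspaceT; exact: continuous_disc.
  by rewrite disc_period.
move: ci; rewrite in_itv /= => /andP[c1 c2]; exists c; split => //.
rewrite leNgt; apply/negP => x1; have [y0 b0] := critical_central (ltW x1) dc.
have := sqr_cmod_tcoef c; rewrite y0 b0 cmod0 expr0n !addr0 /= => /eqP.
by rewrite -real_normK ?num_real // pexpr_eq1 ?normr_ge0 //= => /eqP h; move: x1; rewrite h ltxx.
Qed.

Lemma trace_disc t : cmod (\tr (transfer_mx beta n (expi t))) = 2 * `|disc t|.
Proof.
by rewrite -expi_half (cmod_trace_transfer hbeta) ?expiJ ?cmod_expi.
Qed.

(** The band is cut out by the last exit from and the next exit to {|disc| >= 1}; it is no
    longer than a turn because |disc| has period 2 pi. *)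
Lemma elliptic_in_band t : `|disc t| < 1 ->
  exists l u, is_band beta n l u /\ l < t < u.
Proof.
move=> x1; pose g s := `|disc s|.
have gc : continuous g.
  by move=> s; apply: continuous_comp; [exact: continuous_disc|exact: norm_continuous].
have pi0 := pi_gt0 R.
have [c [_ c2 gc1]] := nonelliptic_between (t - 4 * pi).
have [c' [c1' _ gc1']] := nonelliptic_between t.
have [|l [_ lt gl hl]] := last_exit gc _ gc1 x1; first by move: c2; rewrite subrK => /ltW.
have [|u [_ tu gu hu]] := first_exit gc _ gc1' x1; first exact: ltW.
exists l, u; rewrite lt tu; split => //.
have lu s : l < s < u -> g s < 1.
  move=> /andP[ls su]; have [st|ts] := leP s t; first by apply: hl; rewrite ls.
  by apply: hu; rewrite su ltW.
split.
- apply/andP; split; first exact: lt_trans tu.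
  rewrite leNgt; apply/negP => h.
  have : g (l + 2 * pi) < 1 by apply: lu; rewrite h andbT; lra.
  have : 2 * g (l + 2 * pi) = 2 * g l by rewrite -!trace_disc expi_2pi.
  rewrite gl; lra.
- by rewrite trace_disc -/(g l) gl mulr1.
- by rewrite trace_disc -/(g u) gu mulr1.
- by move=> s /lu; rewrite trace_disc -/(g s); lra.
Qed.

Lemma continuous_expi : continuous (fun t : R => expi t : R[i]^o).
Proof.
move=> t; apply/cvgrPdist_lt => e; rewrite ltcE /= => /andP[/eqP e1 e0].
have e2 : 0 < complex.Re e / 2 by rewrite divr_gt0.
have /cvgrPdist_lt/(_ _ e2) hc := @continuous_cos R t.
have /cvgrPdist_lt/(_ _ e2) hs := @continuous_sin R t.
near=> s; rewrite normE ltcE /= e1 eqxx /=.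
apply: le_lt_trans (cmod_le_ReIm (expi t - expi s)) _ => /=.
have : `|cos t - cos s| < complex.Re e / 2 by near: s.
have : `|sin t - sin s| < complex.Re e / 2 by near: s.
lra.
Unshelve. all: by end_near. Qed.

Lemma hyperbolic_off_bands t :
  ~ closure (Gamma_bands beta n : set R[i]^o) (expi t) -> 1 < `|disc t|.
Proof.
move=> hz; rewrite ltNge; apply/negP => x1; apply: hz => U.
move=> /(continuous_expi (x := t)) /nbhs_ballP[d /= d0 hd].
have [s [sd sx]] := elliptic_dense x1 d0.
have [l [u [hband lsu]]] := elliptic_in_band sx.
exists (expi s); split; last by apply: hd; rewrite /ball /= distrC.
by exists l, u; split => //; exists s.
Qed.

End Bands.

(** * Szego orbits off the bands *)

Section Hyperbolic.
Variable R : realType.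

Lemma real_eigenvalues (x : R) : 1 < `|x| ->
  exists l1 l2 : R, [/\ l1 + l2 = 2 * x, l1 * l2 = 1, 1 < `|l1| & `|l2| < 1].
Proof.
move=> x1.
have [y [yy [y1 xy]]] : exists y : R, y ^+ 2 = x ^+ 2 - 1 /\ 1 < `|x + y| /\ x + y != 0.
  pose r := Num.sqrt (x ^+ 2 - 1).
  have r2 : r ^+ 2 = x ^+ 2 - 1.
    by rewrite sqr_sqrtr // subr_ge0 -real_normK ?num_real // exprn_ege1 // ltW.
  have r0 : 0 <= r by exact: sqrtr_ge0.
  have [x0|x0] := leP 0 x.
    exists r; rewrite ger0_norm ?addr_ge0 //; move: x1; rewrite ger0_norm // => x1.
    by split => //; split; [lra|rewrite gt_eqF //; lra].
  exists (- r); rewrite sqrrN; move: x1; rewrite (ltr0_norm x0) => x1.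
  split => //; rewrite ltr0_norm; last by lra.
  by split; [lra|rewrite lt_eqF //; lra].
exists (x + y), (x - y).
have prod1 : (x + y) * (x - y) = 1 by rewrite mulrC -subr_sqr yy; ring.
split => //; first by ring.
have : `|x + y| * `|x - y| = 1 by rewrite -normrM prod1 normr1.
move: (normr_ge0 (x - y)); nra.
Qed.

End Hyperbolic.

Section SzegoOrbit.
Variables (R : realType) (p : nat) (al be : nat -> R[i]) (s : R[i]) (F : nat -> R[i]).
Hypothesis p0 : (0 < p)%N.
Hypothesis hal : forall n, cmod (al n) < 1.
Hypothesis hbe : forall n, cmod (be n) < 1.
Hypothesis hper : forall n, be n = be (n + p)%N.
Hypothesis hlim : tends (fun n => al n - be n) 0.
Hypothesis hsum : summ (fun n => cmod (al (n + p)%N - al n)).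
Hypothesis hs : s * s^* = 1.
Hypothesis F0 : F 0%N != 0.
Hypothesis hF : forall n,
  F n.+1 = (rho al n)^-1 * (s * F n - (al n)^* * s^* * (F n)^*).

Lemma be_period k j : be (k * p + j)%N = be j.
Proof.
elim: k => [|k IH]; first by rewrite mul0n add0n.
by rewrite -IH [RHS]hper mulSn; congr be; lia.
Qed.

Lemma bv_al j : bv (fun k => al (k * p + j)%N).
Proof.
have := summ_progression j p0 (fun n => cmod_ge0 _) hsum.
by apply: summ_le => k; rewrite mulSn (_ : (p + k * p + j = k * p + j + p)%N) //; lia.
Qed.

Lemma tends_al j : tends (fun k => al (k * p + j)%N) (be j).
Proof.
move=> e /hlim [N hN]; exists N => k Nk.
have := hN (k * p + j)%N; rewrite subr0 be_period; apply.
by rewrite (leq_trans Nk) // (leq_trans (leq_pmulr k p0)) ?leq_addr.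
Qed.

Lemma al_uniform j : exists2 A, A < 1 & forall k, cmod (al (k * p + j)%N) <= A.
Proof. exact: (tends_uniform_lt1 _ (hbe j) (tends_al j)). Qed.

Lemma one_minus_al j : exists2 c, 0 < c &
  forall k, c <= 1 - cmod (al (k * p + j)%N) ^+ 2 /\ c <= 1 - cmod (al (k * p + j)%N).
Proof.
have [A A1 hA] := al_uniform j; exists (1 - A); first by rewrite subr_gt0.
move=> k; have := hA k; have := cmod_ge0 (al (k * p + j)%N); split; nra.
Qed.

Lemma sqr_rho_bv j : bv (fun k => rho al (k * p + j) ^+ 2).
Proof.
apply: (@eq_bv _ (fun k => 1 - al (k * p + j)%N * (al (k * p + j)%N)^*)).
  by move=> k; rewrite sqr_rho.
by apply: bvB; [exact: bv_cst|apply: bvM; [|apply: bv_conj]; exact: bv_al].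
Qed.

Lemma rho_lower_bound j : exists2 c, 0 < c &
  forall k, c <= Num.sqrt (1 - cmod (al (k * p + j)%N) ^+ 2).
Proof.
have [c c0 hc] := one_minus_al j; exists (Num.sqrt c); first by rewrite sqrtr_gt0.
by move=> k; rewrite ler_wsqrtr //; have [] := hc k.
Qed.

Lemma rhoV_bv j : bv (fun k => (rho al (k * p + j))^-1).
Proof.
have [c c0 hc] := rho_lower_bound j.
apply: (bvV c0).
  by move=> k; rewrite cmod_real; apply: le_trans (ler_norm _).
by apply: (bv_sqrt c0 hc); exact: sqr_rho_bv.
Qed.

Lemma rhoV_tends j : tends (fun k => (rho al (k * p + j))^-1) (rho be j)^-1.
Proof.
apply: tendsV; first exact: rho_neq0.
apply: tends_sqrt => [|k|].
- by rewrite sqrtr_gt0 subr_gt0 expr_lt1 ?cmod_ge0.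
- exact: sqrtr_ge0.
rewrite -/(rho be j) sqr_rho //.
have h := tends_al j.
apply: eq_tends (tendsB (tends_cst 1) (tendsM h (tends_conj h))) => k.
by rewrite -/(rho al _) sqr_rho.
Qed.

Local Definition block_a j k := ta (fun i => al (k * p + i)%N) s j.
Local Definition block_b j k := tb (fun i => al (k * p + i)%N) s j.

Lemma block_bv j : bv (block_a j) /\ bv (block_b j).
Proof.
elim: j => [|j [hA hB]]; first by split; exact: bv_cst.
have hr : bv (fun k => (rho (fun i => al (k * p + i)%N) j)^-1) by exact: rhoV_bv.
have cross (u v : nat -> R[i]) : bv u -> bv v ->
    bv (fun k => s * u k - (al (k * p + j)%N)^* * s^* * (v k)^*).
  move=> hu hv; apply: bvB; first by apply: bvM hu; exact: bv_cst.
  apply: bvM (bv_conj hv); apply: bvM (bv_cst _); apply: bv_conj; exact: bv_al.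
split.
  by apply: eq_bv (bvM hr (cross _ _ hA hB)) => k; rewrite /block_a taS.
by apply: eq_bv (bvM hr (cross _ _ hB hA)) => k; rewrite /block_b tbS.
Qed.

Lemma block_tends j : tends (block_a j) (ta be s j) /\ tends (block_b j) (tb be s j).
Proof.
elim: j => [|j [hA hB]]; first by split; exact: tends_cst.
have hr : tends (fun k => (rho (fun i => al (k * p + i)%N) j)^-1) (rho be j)^-1.
  exact: rhoV_tends.
have cross (u v : nat -> R[i]) a b : tends u a -> tends v b ->
    tends (fun k => s * u k - (al (k * p + j)%N)^* * s^* * (v k)^*)
      (s * a - (be j)^* * s^* * b^*).
  move=> hu hv.
  exact: (tendsB (tendsM (tends_cst s) hu)
    (tendsM (tendsM (tends_conj (tends_al j)) (tends_cst _)) (tends_conj hv))).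
split.
  by rewrite taS; apply: eq_tends (tendsM hr (cross _ _ _ _ hA hB)) => k; rewrite /block_a taS.
by rewrite tbS; apply: eq_tends (tendsM hr (cross _ _ _ _ hB hA)) => k; rewrite /block_b tbS.
Qed.

Lemma block_step j k : F (k * p + j)%N = block_a j k * F (k * p)%N + block_b j k * (F (k * p)%N)^*.
Proof.
elim: j => [|j IH]; first by rewrite addn0 /block_a /block_b ta0 tb0 mul1r mul0r addr0.
rewrite addnS hF IH /block_a /block_b taS tbS -/(block_a j k) -/(block_b j k).
rewrite (_ : rho (fun i => al (k * p + i)%N) j = rho al (k * p + j)) //.
by rewrite !(rmorphD, rmorphM) /= conjCK; ring.
Qed.

Lemma cmod_s : cmod s = 1.
Proof.
apply: complexI; rewrite -normE.
by apply/eqP; rewrite -(@pexpr_eq1 _ _ 2) // normCK hs.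
Qed.

Lemma F_neq0 n : F n != 0.
Proof.
elim: n => [//|n IH]; rewrite hF mulf_neq0 ?invr_eq0 ?rho_neq0 //.
rewrite subr_eq0; apply/negP => /eqP /(congr1 (fun z => cmod z)).
rewrite !cmodM !cmod_conj cmod_s mul1r mulr1 -[LHS]mul1r => /eqP.
by rewrite (inj_eq (mulIf _)) ?cmod_eq0 // => /eqP h; have := hal n; rewrite -h ltxx.
Qed.

Hypothesis hyper : 1 < `|complex.Re (ta be s p)|.

(** The combinations conj F - w F with w = w1, w2 are left eigenvectors of the periodic
    p-step map F |-> a F + b conj F. Its eigenvalues are real since its trace 2 Re a and
    determinant 1 are; b is not 0 since |a|^2 = 1 + |b|^2 while |Re a| > 1. *)
Lemma left_eigenvectors : exists l1 l2 w1 w2 : R[i],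
  let a := ta be s p in let b := tb be s p in
  [/\ 1 < cmod l1, cmod l2 < 1, w1 != w2,
      a^* - w1 * b = l1 /\ b^* - w1 * a = - (w1 * l1) &
      a^* - w2 * b = l2 /\ b^* - w2 * a = - (w2 * l2)].
Proof.
have [l1 [l2 [tr det h1 h2]]] := real_eigenvalues hyper.
have det' := tcoef_det hbe hs p.
move: hyper tr det' => /=; move: (ta be s p) (tb be s p) => a b hyp tr det'.
have b0 : b != 0.
  apply: contraTneq hyp => b0; rewrite -leNgt; apply: le_trans (Re_le_cmod _) _.
  have : (cmod a ^+ 2)%:C = 1%:C by rewrite sqr_cmod rmorph1 -det' b0 mul0r subr0.
  by move/complexI/eqP; rewrite pexpr_eq1 ?cmod_ge0 // => /eqP ->.
have trC : a + a^* = l1%:C + l2%:C.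
  rewrite -rmorphD tr; case: a {hyp det' tr} => x y.
  by apply/eqP; rewrite eq_complex /=; apply/andP; split; apply/eqP; ring.
have detC : l1%:C * l2%:C = 1 :> R[i] by rewrite -rmorphM det.
have l12 : l1%:C - l2%:C != 0 :> R[i].
  by rewrite subr_eq0; apply: contraTneq h1 => /complexI ->; rewrite -leNgt ltW.
exists l1%:C, l2%:C, ((a^* - l1%:C) / b), ((a^* - l2%:C) / b).
move: trC detC l12 det'; rewrite !cmod_real.
move: (a^*) (b^*) (l1%:C) (l2%:C) => a' b' L1 L2 trC detC l12 det'.
have a'E : a' = L1 + L2 - a by rewrite -trC; ring.
have key L L' : L + L' = L1 + L2 -> L * L' = 1 ->
    b' - (a' - L) / b * a = - ((a' - L) / b * L).
  move=> e1 e2; apply: (mulIf b0).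
  have -> : (b' - (a' - L) / b * a) * b = b * b' - (a' - L) * a by field.
  have -> : - ((a' - L) / b * L) * b = - ((a' - L) * L) by field.
  apply/eqP; rewrite -subr_eq0 a'E -e1; apply/eqP.
  transitivity (b * b' - a * a' + L * L'); first by rewrite a'E -e1; ring.
  by rewrite e2 -det'; ring.
split => //.
- rewrite -subr_eq0 -mulrBl mulf_neq0 ?invr_eq0 // opprB addrC addrA subrK.
  by rewrite -oppr_eq0 opprD opprK addrC.
- by split; [field|apply: key detC].
- by split; [field|apply: (key _ L1); rewrite 1?addrC 1?mulrC].
Qed.

(** In the coordinates conj F - w1 F and conj F - w2 F the limiting p-step map is
    diagonal, so that [dichotomy] applies to the p-step maps along alpha. *)
Lemma growth_or_decay :
  (exists c r, [/\ 0 < c, 0 < r < 1 & forall k, cmod (F (k * p)%N) <= c * r ^+ k]) \/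
  (bv (fun k => (F (k * p)%N)^* / F (k * p)%N) /\
   exists2 l, 1 < cmod l & tends (fun k => F (k.+1 * p)%N / F (k * p)%N) l).
Proof.
have [l1 [l2 [w1 [w2 /= [h1 h2 w12 [e1 e1'] [e2 e2']]]]]] := left_eigenvectors.
have dw : w2 - w1 != 0 by rewrite subr_eq0 eq_sym.
have [bA bB] := block_bv p; have [tA tB] := block_tends p.
pose f k := F (k * p)%N.
pose x k := (f k)^* - w1 * f k; pose y k := (f k)^* - w2 * f k.
have fE k : f k = (x k - y k) / (w2 - w1) by rewrite /x /y; field.
have fJE k : (f k)^* = (w2 * x k - w1 * y k) / (w2 - w1) by rewrite /x /y; field.
pose P w k := (block_a p k)^* - w * block_b p k; pose Q w k := (block_b p k)^* - w * block_a p k.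
have bP w : bv (P w) by apply: bvB (bv_conj bA) (bvM (bv_cst w) bB).
have bQ w : bv (Q w) by apply: bvB (bv_conj bB) (bvM (bv_cst w) bA).
have tP w : tends (P w) ((ta be s p)^* - w * tb be s p).
  exact: tendsB (tends_conj tA) (tendsM (tends_cst w) tB).
have tQ w : tends (Q w) ((tb be s p)^* - w * ta be s p).
  exact: tendsB (tends_conj tB) (tendsM (tends_cst w) tA).
have step w k : (f k.+1)^* - w * f k.+1 = P w k * (f k)^* + Q w k * f k.
  rewrite /f (_ : (k.+1 * p = k * p + p)%N); last by rewrite mulSn addnC.
  by rewrite block_step rmorphD !rmorphM /= conjCK /P /Q; ring.
pose M w v k := (P w k * v + Q w k) / (w2 - w1).
have bM w v : bv (M w v).
  exact: bvM (bvD (bvM (bP w) (bv_cst v)) (bQ w)) (bv_cst _).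
have tM w v : tends (M w v) ((((ta be s p)^* - w * tb be s p) * v +
    ((tb be s p)^* - w * ta be s p)) / (w2 - w1)).
  exact: tendsM (tendsD (tendsM (tP w) (tends_cst v)) (tQ w)) (tends_cst _).
have stepM w k : (f k.+1)^* - w * f k.+1 = M w w2 k * x k + - M w w1 k * y k.
  by rewrite step fJE {1}fE /M; field.
have L1 : tends (M w1 w2) l1.
  by have := tM w1 w2; rewrite e1 e1' (_ : _ / _ = l1) //; field.
have L2 : tends (fun k => - M w1 w1 k) 0.
  by have := tendsN (tM w1 w1); rewrite e1 e1' (_ : - _ = 0) //; field.
have L3 : tends (M w2 w2) 0.
  by have := tM w2 w2; rewrite e2 e2' (_ : _ / _ = 0) //; field.
have L4 : tends (fun k => - M w2 w1 k) l2.
  by have := tendsN (tM w2 w1); rewrite e2 e2' (_ : - _ = l2) //; field.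
have fn0 k : f k != 0 by exact: F_neq0.
have xy0 k : ~ (x k = 0 /\ y k = 0).
  by case=> x0 y0; have := fn0 k; rewrite fE x0 y0 subr0 mul0r eqxx.
have [[c [r [c0 r01 hxy]]]|[m [xn0 bt t0 tx]]] := dichotomy (fun k => stepM w1 k)
    (fun k => stepM w2 k) xy0 L1 L2 L3 L4 (bM _ _) (bvN (bM _ _)) (bM _ _) (bvN (bM _ _)) h1 h2.
  left; exists (c / cmod (w2 - w1)), r.
  have d0 : 0 < cmod (w2 - w1) by rewrite cmod_gt0.
  split => //; first by rewrite divr_gt0.
  move=> k; rewrite -/(f k) fE cmodM cmodV mulrAC ler_pM2r ?invr_gt0 //.
  exact: le_trans (cmodB _ _) (hxy k).
right.
pose t := cone_ratio x y m.
have yE k : y (m + k)%N = t k * x (m + k)%N by rewrite /t /cone_ratio divfK.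
have [N hN] : exists N, forall k, (N <= k)%N -> cmod (t k) < 2^-1.
  have half0 : 0 < 2^-1 :> R by rewrite invr_gt0.
  have [N hN] := t0 _ half0.
  by exists N => k /hN; rewrite subr0.
have t1 k : 2^-1 <= cmod (1 - t (N + k)%N).
  have := cmodB_ge 1 (t (N + k)%N); rewrite cmod1; have := hN _ (leq_addr k N); lra.
have t10 k : 1 - t (N + k)%N != 0 by rewrite -cmod_gt0; have := t1 k; lra.
have half0 : 0 < 2^-1 :> R by rewrite invr_gt0.
have fE' k : f (m + (N + k))%N = x (m + (N + k))%N * (1 - t (N + k)%N) / (w2 - w1).
  by rewrite fE yE; congr (_ / _); ring.
have bt' : bv (fun k => t (N + k)%N) by apply/bv_shift.
have tt' : tends (fun k => t (N + k)%N) 0 by exact: tends_shift.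
split.
  apply/(bv_shift _ m)/(bv_shift _ N).
  apply: (@eq_bv _ (fun k => (w2 - w1 * t (N + k)%N) / (1 - t (N + k)%N))).
    move=> k; rewrite -/(f _) fJE fE' yE.
    have := xn0 (N + k)%N; have := t10 k; move: (t _) (x _) => t_ x_ t_0 x_0.
    by field; rewrite t_0 x_0 dw.
  apply: (bv_div half0 t1); apply: bvB (bv_cst _) _ => //.
  exact: bvM (bv_cst _) bt'.
exists l1 => //.
have ratio : tends (fun k => x (m + (N + k)).+1 / x (m + (N + k))%N *
    ((1 - t (N + k.+1)%N) / (1 - t (N + k)%N))) l1.
  have u1 : tends (fun k => 1 - t (N + k)%N) 1.
    by rewrite -[X in tends _ X]subr0; exact: tendsB (tends_cst 1) tt'.
  have := tendsM (tends_shift N tx)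
    (tendsM (tends_shift 1 u1) (tendsV (oner_neq0 _) u1)).
  by rewrite invr1 !mulr1.
move=> e /ratio [K hK]; exists (m + (N + K))%N => k hk.
have [k' -> Kk'] : exists2 k', k = (m + (N + k'))%N & (K <= k')%N.
  by exists (k - m - N)%N; lia.
have := hK _ Kk'; congr (cmod (_ - _) < _).
rewrite -[F (_.+1 * p)%N]/(f _.+1) -/(f _) -!addnS !fE' addnS.
have := xn0 (N + k')%N; have := t10 k'; rewrite !addnS.
by move: (t (N + k')%N) (x _) => t_ x_ t_0 x_0; field; rewrite t_0 x_0 dw.
Qed.

Variable c : R.
Hypothesis c0 : 0 < c.

Local Definition kernel_sum n : R := \sum_(0 <= j < n.+1) cmod (F j) ^+ 2.

(** Delta_n in terms of the orbit F ([Delta_orbit]); c stands for (1 - gamma) / gamma. *)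
Definition orbit_delta n : R[i] :=
  ((s^*) ^+ 2 * (F n)^* ^+ 2 - al n * (cmod (F n) ^+ 2)%:C) / (c + kernel_sum n)%:C.

Lemma kernel_sum_ge0 n : 0 <= kernel_sum n.
Proof. by apply: sumr_ge0 => j _; rewrite sqr_ge0. Qed.

Lemma decay_case C r : 0 < C -> 0 < r < 1 ->
  (forall k, cmod (F (k * p)%N) <= C * r ^+ k) ->
  summ (fun n => cmod (F n) ^+ 2) /\
  forall j, exponentially_fast (fun k => orbit_delta (k * p + j)).
Proof.
move=> C0 r01 hF0; have /andP[r0 r1] := r01.
have decay j : exists2 D, 0 < D & forall k, cmod (F (k * p + j)%N) ^+ 2 <= D * r ^+ k.
  have [bA bB] := block_bv j.
  have [a a0 ha] := bv_bounded bA; have [b b0 hb] := bv_bounded bB.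
  have ab0 : 0 < (a + b) * C by rewrite mulr_gt0 ?addr_gt0.
  exists (((a + b) * C) ^+ 2); first by rewrite exprn_gt0.
  move=> k; have rk0 : 0 <= r ^+ k by rewrite exprn_ge0 // ltW.
  have le1 : cmod (F (k * p + j)%N) <= (a + b) * C * r ^+ k.
    rewrite block_step; apply: le_trans (cmodD _ _) _.
    rewrite !cmodM cmod_conj -mulrDl -mulrA.
    by apply: ler_pM; rewrite ?addr_ge0 ?cmod_ge0 // lerD.
  apply: le_trans (_ : ((a + b) * C * r ^+ k) ^+ 2 <= _).
    by rewrite ler_sqr ?nnegrE ?cmod_ge0 // mulr_ge0 // ltW.
  rewrite exprMn ler_pM2l ?exprn_gt0 // expr2 ler_piMr //.
  by rewrite exprn_ile1 // ltW.
split.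
  apply: (summ_of_progressions p0) => [k|j _]; first exact: sqr_ge0.
  have [D _ hD] := decay j; apply: summ_le hD _; exact: summ_geometric.
move=> j; have [D D0 hD] := decay j.
exists (2 / c * D), r; split => //; first by rewrite mulr_gt0 ?divr_gt0.
move=> k; rewrite cmodM cmodV cmod_real ger0_norm ?addr_ge0 ?kernel_sum_ge0 ?(ltW c0) //.
have cK : c <= c + kernel_sum (k * p + j) by rewrite lerDl kernel_sum_ge0.
have num : cmod ((s^*) ^+ 2 * (F (k * p + j)%N)^* ^+ 2 -
    al (k * p + j)%N * (cmod (F (k * p + j)%N) ^+ 2)%:C) <= 2 * (D * r ^+ k).
  apply: le_trans (cmodB _ _) _; rewrite (cmodM (_ ^+ 2)) (cmodM (al _)) !cmodX !cmod_conj cmod_s cmod_real.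
  rewrite ger0_norm ?sqr_ge0 // expr1n mul1r.
  have := hD k; have := hal (k * p + j)%N; have := cmod_ge0 (al (k * p + j)%N).
  have := sqr_ge0 (cmod (F (k * p + j)%N)); nra.
rewrite ler_pdivrMr ?(lt_le_trans c0) //; apply: le_trans num _.
have -> : 2 / c * D * r ^+ k * (c + kernel_sum (k * p + j)) =
    2 * (D * r ^+ k) * ((c + kernel_sum (k * p + j)) / c).
  by field; rewrite gt_eqF.
rewrite ler_peMr ?ler_pdivlMr ?mul1r //.
by rewrite !mulr_ge0 ?exprn_ge0 // ltW.
Qed.

(** The one-step recursion acts on this unimodular direction by a homography. *)
Local Definition phase n := (F n)^* / F n.

Lemma cmod_phase n : cmod (phase n) = 1.
Proof. by rewrite cmodM cmodV cmod_conj divff // cmod_eq0 F_neq0. Qed.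

Lemma F_next n : F n.+1 = (rho al n)^-1 * (s - (al n)^* * s^* * phase n) * F n.
Proof.
by rewrite hF /phase -[RHS]mulrA mulrBl -[_ * (_ / _) * _]mulrA divfK ?F_neq0.
Qed.

Lemma denominator_lower_bound j : exists2 d, 0 < d & forall k,
  d <= cmod (s - (al (k * p + j)%N)^* * s^* * phase (k * p + j)).
Proof.
have [d d0 hd] := one_minus_al j; exists d => // k.
have [_ h] := hd k; apply: le_trans h _; apply: le_trans (cmodB_ge _ _).
by rewrite (cmodM _ (phase _)) cmod_phase cmodM !cmod_conj cmod_s !mulr1.
Qed.

Section Growth.
Hypothesis bW0 : bv (fun k => phase (k * p)).
Variable l : R[i].
Hypothesis l1 : 1 < cmod l.
Hypothesis tl : tends (fun k => F (k.+1 * p)%N / F (k * p)%N) l.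

(** The pole of the one-step homography stays away from the circle, as |alpha_n| does from
    1. *)
Lemma phase_bv j : bv (fun k => phase (k * p + j)).
Proof.
elim: j => [|j IH]; first by under eq_fun do rewrite addn0.
have [d d0 hd] := denominator_lower_bound j.
pose a k := al (k * p + j)%N.
apply: (@eq_bv _ (fun k => (s^* * phase (k * p + j) - a k * s) /
    (s - (a k)^* * s^* * phase (k * p + j)))); last first.
  apply: (bv_div d0 hd); apply: bvB.
  - exact: bvM (bv_cst _) IH.
  - exact: bvM (bv_al j) (bv_cst _).
  - exact: bv_cst.
  - exact: bvM (bvM (bv_conj (bv_al j)) (bv_cst _)) IH.
move=> k; rewrite addnS /phase [in RHS]F_next -/(phase _) -/(a k).
have := hd k; rewrite -/(a k); set D := s - _ => hD.
have D0 : D != 0 by rewrite -cmod_gt0 (lt_le_trans d0).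
have r0 := rho_neq0 (hal (k * p + j)).
have Fn := F_neq0 (k * p + j); have FJn : (F (k * p + j)%N)^* != 0 by rewrite conjC_eq0.
have WJ : (phase (k * p + j))^* = (phase (k * p + j))^-1.
  by rewrite /phase fmorph_div /= conjCK invf_div.
have DJ : D^* = s^* - a k * s / phase (k * p + j).
  by rewrite /D rmorphB /= 2!rmorphM /= !conjCK WJ.
rewrite !rmorphM fmorphV /= conj_rho DJ.
rewrite /phase; by move: D D0 {hD DJ} => D D0; field; rewrite Fn FJn r0 D0.
Qed.

Lemma inv_growth_bv j :
  bv (fun k => (cmod (F (k * p + j)%N) ^+ 2)%:C / (cmod (F (k * p + j).+1) ^+ 2)%:C).
Proof.
have [d d0 hd] := denominator_lower_bound j.
pose D k := s - (al (k * p + j)%N)^* * s^* * phase (k * p + j).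
have bD : bv D.
  apply: bvB (bv_cst _) _; exact: bvM (bvM (bv_conj (bv_al j)) (bv_cst _)) (phase_bv j).
apply: (@eq_bv _ (fun k => rho al (k * p + j) ^+ 2 / (D k * (D k)^*))).
  move=> k; rewrite F_next -/(D k) !sqr_cmod !rmorphM fmorphV /= conj_rho.
  have r0 := rho_neq0 (hal (k * p + j)); have Fn := F_neq0 (k * p + j).
  have FJn : (F (k * p + j)%N)^* != 0 by rewrite conjC_eq0.
  have D0 : D k != 0 by rewrite -cmod_gt0; exact: lt_le_trans d0 (hd k).
  have DJ0 : (D k)^* != 0 by rewrite conjC_eq0.
  by field; rewrite Fn FJn r0 D0 DJ0.
apply: (@bv_div _ _ _ (d * d)); first by rewrite mulr_gt0.
- by move=> k; rewrite cmodM cmod_conj; apply: ler_pM; rewrite ?(ltW d0) //; exact: hd.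
- exact: sqr_rho_bv.
- exact: bvM bD (bv_conj bD).
Qed.

(** Dividing the denominator of Delta_n by |F_n|^2 leaves an affine recursion
    ([kernel_ratio_next]) whose multiplier is the inverse growth of |F|^2. *)
Local Definition kernel_ratio n : R[i] := (c + kernel_sum n)%:C / (cmod (F n) ^+ 2)%:C.

Lemma sqF_neq0 n : (cmod (F n) ^+ 2)%:C != 0 :> R[i].
Proof. by rewrite sqr_cmod mulf_neq0 ?conjC_eq0 ?F_neq0. Qed.

Lemma kernel_ratio_next n :
  kernel_ratio n.+1 = 1 + (cmod (F n) ^+ 2)%:C / (cmod (F n.+1) ^+ 2)%:C * kernel_ratio n.
Proof.
have KS : (c + kernel_sum n.+1)%:C = (c + kernel_sum n)%:C + (cmod (F n.+1) ^+ 2)%:C :> R[i].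
  by rewrite -rmorphD /kernel_sum big_nat_recr //= addrA.
rewrite /kernel_ratio KS.
move: (sqF_neq0 n) (sqF_neq0 n.+1); move: (_%:C) (_%:C) (_%:C) => x y z y0 z0.
by field; rewrite y0 z0.
Qed.

Lemma kernel_ratio_block j : exists b : nat -> R[i], bv b /\
  forall k, kernel_ratio (k * p + j) = b k +
    (cmod (F (k * p)%N) ^+ 2)%:C / (cmod (F (k * p + j)%N) ^+ 2)%:C * kernel_ratio (k * p).
Proof.
elim: j => [|j [b [bb hb]]].
  exists (fun=> 0); split; first exact: bv_cst.
  by move=> k; rewrite addn0 divff ?sqF_neq0 // mul1r add0r.
pose g k : R[i] := (cmod (F (k * p + j)%N) ^+ 2)%:C / (cmod (F (k * p + j).+1) ^+ 2)%:C.
exists (fun k => 1 + g k * b k); split.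
  exact: bvD (bv_cst _) (bvM (inv_growth_bv j) bb).
move=> k; rewrite addnS kernel_ratio_next -/(g k) hb /g.
move: (sqF_neq0 (k * p + j)) (sqF_neq0 (k * p + j).+1).
move: ((cmod (F (k * p + j)%N) ^+ 2)%:C) ((cmod (F (k * p + j).+1) ^+ 2)%:C) (_%:C).
by move=> x y z x0 y0; field; rewrite x0 y0.
Qed.

Lemma inv_growth_block_bv j :
  bv (fun k => (cmod (F (k * p)%N) ^+ 2)%:C / (cmod (F (k * p + j)%N) ^+ 2)%:C).
Proof.
elim: j => [|j IH].
  by apply: eq_bv (bv_cst 1) => k; rewrite addn0 divff ?sqF_neq0.
apply: eq_bv (bvM IH (inv_growth_bv j)) => k.
rewrite addnS; move: (sqF_neq0 (k * p + j)) (sqF_neq0 (k * p + j).+1).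
move: ((cmod (F (k * p + j)%N) ^+ 2)%:C) ((cmod (F (k * p + j).+1) ^+ 2)%:C) (_%:C).
by move=> x y z x0 y0; field; rewrite x0 y0.
Qed.

Lemma eventually_growing : exists N q, 1 < q /\
  forall k, (N <= k)%N -> q * cmod (F (k * p)%N) <= cmod (F (k.+1 * p)%N).
Proof.
have [|N hN] := tl (eps := (cmod l - 1) / 2); first by rewrite divr_gt0 ?subr_gt0.
exists N, ((1 + cmod l) / 2); split; first by rewrite ltr_pdivlMr ?ltr0n //; move: l1; lra.
move=> k /hN; set z := F _ / F _ => hz.
have -> : F (k.+1 * p)%N = z * F (k * p)%N by rewrite /z divfK ?F_neq0.
rewrite cmodM ler_wpM2r ?cmod_ge0 //.
have := cmodB_ge l (l - z); rewrite (_ : l - (l - z) = z); last by ring.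
rewrite (cmodC l z); lra.
Qed.

(** For j = 0 the p-step recursion contracts eventually, |F_(kp)| growing geometrically;
    the other j follow from j = 0. *)
Lemma kernel_ratio_bv j : bv (fun k => kernel_ratio (k * p + j)).
Proof.
have [N [q [q1 hq]]] := eventually_growing.
have bS0 : bv (fun k => kernel_ratio (k * p)).
  have [b [bb hb]] := kernel_ratio_block p.
  have q2 : (q ^+ 2)^-1 < 1.
    by rewrite invf_lt1 ?exprn_gt0 ?(lt_trans ltr01) // exprn_egt1.
  apply: (@bv_affine _ _ b _ _ N _ bb (inv_growth_block_bv p) q2).
    by move=> k; rewrite mulSn addnC hb.
  move=> k /hq; rewrite mulSn addnC => h.
  have Fk : 0 < cmod (F (k * p)%N) by rewrite cmod_gt0 F_neq0.
  have Fk' : 0 < cmod (F (k * p + p)%N) by rewrite cmod_gt0 F_neq0.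
  rewrite cmodM cmodV !cmod_real !ger0_norm ?sqr_ge0 //.
  rewrite ler_pdivrMr ?exprn_gt0 // ler_pdivlMl ?exprn_gt0 ?(lt_trans ltr01) //.
  rewrite -exprMn ler_sqr ?nnegrE ?cmod_ge0 // mulr_ge0 ?cmod_ge0 //.
  by rewrite ltW // (lt_trans ltr01).
have [b [bb hb]] := kernel_ratio_block j.
by apply: eq_bv (bvD bb (bvM (inv_growth_block_bv j) bS0)) => k; rewrite hb.
Qed.

Lemma growth_case : ~ summ (fun n => cmod (F n) ^+ 2) /\
  forall j, bv (fun k => orbit_delta (k * p + j)).
Proof.
split.
  have [N [q [q1 hq]]] := eventually_growing.
  move=> /(summ_progression 0 p0 (fun n => sqr_ge0 _)) h.
  have FN : 0 < cmod (F (N * p)%N) ^+ 2 by rewrite exprn_gt0 // cmod_gt0 F_neq0.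
  have ge k : cmod (F (N * p)%N) ^+ 2 <= cmod (F ((N + k) * p + 0)%N) ^+ 2.
    rewrite addn0 ler_sqr ?nnegrE ?cmod_ge0 //.
    elim: k => [|k IH]; first by rewrite addn0.
    apply: le_trans IH _; rewrite addnS; apply: le_trans (hq _ (leq_addr k N)).
    by rewrite ler_peMl ?cmod_ge0 // ltW.
  apply: (not_summ_lower_bound FN ge).
  by apply/(summ_shift N (fun k => sqr_ge0 (cmod (F (k * p + 0)%N)))).
move=> j.
have S1 k : 1 <= cmod (kernel_ratio (k * p + j)).
  rewrite cmodM cmodV !cmod_real !ger0_norm ?sqr_ge0 ?addr_ge0 ?kernel_sum_ge0 ?(ltW c0) //.
  rewrite ler_pdivlMr ?exprn_gt0 ?cmod_gt0 ?F_neq0 // mul1r.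
  rewrite /kernel_sum big_nat_recr //= addrA lerDr addr_ge0 ?(ltW c0) //.
  by apply: sumr_ge0 => i _; rewrite sqr_ge0.
apply: eq_bv (bv_div ltr01 S1 (bvB (bvM (bv_cst ((s^*) ^+ 2)) (phase_bv j)) (bv_al j)) (kernel_ratio_bv j)) => k.
rewrite /orbit_delta /kernel_ratio /phase.
have Fn := F_neq0 (k * p + j); have FJn : (F (k * p + j)%N)^* != 0 by rewrite conjC_eq0.
have cK : (c + kernel_sum (k * p + j))%:C != 0 :> R[i].
  by rewrite -cmod_gt0 cmod_real normr_gt0 gt_eqF // ltr_pwDl ?kernel_sum_ge0.
rewrite sqr_cmod; move: cK; move: ((c + _)%:C) => z z0.
by field; rewrite z0 Fn FJn.
Qed.

End Growth.

Lemma orbit_dichotomy :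
  (summ (fun n => cmod (F n) ^+ 2) /\
   forall j, exponentially_fast (fun k => orbit_delta (k * p + j))) \/
  (~ summ (fun n => cmod (F n) ^+ 2) /\
   forall j, bv (fun k => orbit_delta (k * p + j))).
Proof.
have [[C [r [C0 r01 h]]]|[bW [l l1 tl]]] := growth_or_decay.
  by left; exact: decay_case h.
by right; exact: growth_case tl.
Qed.

End SzegoOrbit.

(** * Integration of polynomials on the circle *)

Section Regular.
Variables (R : realType) (mu : probability (borel_circle R) R).
Local Notation T := (borel_circle R).
Implicit Types (f g : unit_circle R -> R[i]).

(** Unlike polynomials, these are closed under conjugation, which covers the integrands
    conj p q of inner products. *)
Definition regular f := [/\ continuous (fun z => complex.Re (f z) : R),
  continuous (fun z => complex.Im (f z) : R) & exists M, forall z, cmod (f z) <= M].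

Lemma measurable_continuous_circle (h : unit_circle R -> R) :
  continuous h -> measurable_fun setT (h : T -> R).
Proof.
move=> hc; apply: (measurability _ (RGenOpens.measurableE R)) => _ [_ [a [b ->] <-]].
rewrite setTI; apply: sub_sigma_algebra.
by apply: open_comp => [z _|]; [exact: hc|exact: interval_open].
Qed.

Lemma continuous_circle_val : continuous (@circle_val R).
Proof. exact: initial_continuous. Qed.

Lemma cvg_part (h : R[i] -> R) : (forall x y, `|h x - h y| <= cmod (x - y)) ->
  continuous (h : R[i]^o -> R).
Proof.
move=> hl x U /nbhs_ballP[e /= e0 hU]; apply/nbhs_ballP.
exists e%:C => /=; first by rewrite ltcR.
by move=> y; rewrite /ball /= normE ltcR => xy; apply: hU; exact: le_lt_trans (hl _ _) xy.
Qed.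

Lemma regular_circle_val : regular (@circle_val R).
Proof.
split.
- move=> z; apply: continuous_comp.
    exact: continuous_circle_val.
  apply: (cvg_part (h := @complex.Re R)) => x y.
  by rewrite -(raddfB (@complex.Re R)) Re_le_cmod.
- move=> z; apply: continuous_comp.
    exact: continuous_circle_val.
  apply: (cvg_part (h := @complex.Im R)) => x y.
  by rewrite -(raddfB (@complex.Im R)) Im_le_cmod.
- exists 1 => -[z hz] /=; rewrite -lecR -normE (eqP hz).
  by rewrite rmorph1.
Qed.

Lemma regular_cst c : regular (fun=> c).
Proof. by split; [exact: cst_continuous|exact: cst_continuous|exists (cmod c)]. Qed.

Lemma regularD f g : regular f -> regular g -> regular (fun z => f z + g z).
Proof.
move=> [f1 f2 [M hM]] [g1 g2 [N hN]]; split.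
- by under eq_fun do rewrite ReD; move=> z; exact: (continuousD (f1 z) (g1 z)).
- by under eq_fun do rewrite ImD; move=> z; exact: (continuousD (f2 z) (g2 z)).
- by exists (M + N) => z; apply: le_trans (cmodD _ _) _; rewrite lerD.
Qed.

Lemma regularM f g : regular f -> regular g -> regular (fun z => f z * g z).
Proof.
move=> [f1 f2 [M hM]] [g1 g2 [N hN]]; split.
- under eq_fun do rewrite Re_mul; move=> z.
  exact: (continuousB (continuousM (f1 z) (g1 z)) (continuousM (f2 z) (g2 z))).
- under eq_fun do rewrite Im_mul; move=> z.
  exact: (continuousD (continuousM (f1 z) (g2 z)) (continuousM (f2 z) (g1 z))).
- by exists (M * N) => z; rewrite cmodM ler_pM ?cmod_ge0.
Qed.

Lemma regular_conj f : regular f -> regular (fun z => (f z)^*).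
Proof.
move=> [f1 f2 [M hM]]; split.
- by under eq_fun do rewrite Re_conj.
- by under eq_fun do rewrite Im_conj; move=> z; exact: (continuousN (f2 z)).
- by exists M => z; rewrite cmod_conj.
Qed.

Lemma regular_horner (p : {poly R[i]}) : regular (fun z => p.[circle_val z]).
Proof.
elim/poly_ind: p => [|p c IH].
  by under eq_fun do rewrite horner0; exact: regular_cst.
under eq_fun do rewrite hornerMXaddC.
by apply: regularD (regular_cst c); exact: regularM IH regular_circle_val.
Qed.

Lemma bounded_integrable (h : T -> R) M : measurable_fun setT h ->
  (forall z, `|h z| <= M) -> mu.-integrable setT (EFin \o h).
Proof.
move=> mh hM; apply: measurable_bounded_integrable => //.
  by rewrite (le_lt_trans (probability_le1 mu _)) ?ltry.
exists M; split; first exact: num_real.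
by move=> y My z _; apply: le_trans (hM z) (ltW My).
Qed.

Lemma regular_Re f : regular f -> mu.-integrable setT (EFin \o (fun z : T => complex.Re (f z))).
Proof.
move=> [f1 _ [M hM]]; apply: (bounded_integrable (M := M)) => [|z]; first exact: measurable_continuous_circle.
exact: le_trans (Re_le_cmod _) (hM z).
Qed.

Lemma regular_Im f : regular f -> mu.-integrable setT (EFin \o (fun z : T => complex.Im (f z))).
Proof.
move=> [_ f1 [M hM]]; apply: (bounded_integrable (M := M)) => [|z]; first exact: measurable_continuous_circle.
exact: le_trans (Im_le_cmod _) (hM z).
Qed.

Lemma cintegralD f g : regular f -> regular g ->
  cintegral mu (fun z => f z + g z) = cintegral mu f + cintegral mu g.
Proof.
move=> hf hg; rewrite /cintegral.
under [X in X +i* _]eq_Rintegral do rewrite ReD.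
under [X in _ +i* X]eq_Rintegral do rewrite ImD.
rewrite !RintegralD //; [exact: regular_Im|exact: regular_Im|exact: regular_Re|exact: regular_Re].
Qed.

Lemma cintegralZ c f : regular f ->
  cintegral mu (fun z => c * f z) = c * cintegral mu f.
Proof.
move=> hf; rewrite /cintegral; case: c => x y.
have h1 := regular_Re hf; have h2 := regular_Im hf.
have Z (r : R) (h : T -> R) : mu.-integrable setT (EFin \o h) ->
  mu.-integrable setT (EFin \o (fun z => r * h z)).
  by move=> ih; apply: eq_integrable (integrableZl _ r ih).
under [X in X +i* _]eq_Rintegral do rewrite Re_mul /=.
under [X in _ +i* X]eq_Rintegral do rewrite Im_mul /=.
by rewrite RintegralB ?RintegralD ?RintegralZl //; exact: Z.
Qed.

Lemma cintegral_conj f : regular f ->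
  cintegral mu (fun z => (f z)^*) = (cintegral mu f)^*.
Proof.
move=> hf; rewrite /cintegral.
under [X in X +i* _]eq_Rintegral do rewrite Re_conj.
under [X in _ +i* X]eq_Rintegral do rewrite Im_conj -mulN1r.
by rewrite RintegralZl ?mulN1r //; exact: regular_Im.
Qed.

Lemma cintegral_real (h : unit_circle R -> R) :
  cintegral mu (fun z => (h z)%:C) = (Rintegral mu setT h)%:C.
Proof.
rewrite /cintegral /=; congr (_ +i* _).
by rewrite (Rintegral_cst mu measurableT 0) mul0r.
Qed.

Definition sqnorm (p : {poly R[i]}) : R :=
  Rintegral mu setT (fun z => cmod p.[circle_val z] ^+ 2).

Implicit Types p q : {poly R[i]}.

Lemma regular_pinner p q : regular (fun z => (p.[circle_val z])^* * q.[circle_val z]).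
Proof. by apply: regularM; [apply: regular_conj|]; exact: regular_horner. Qed.

Lemma pinnerDr p q1 q2 : pinner mu p (q1 + q2) = pinner mu p q1 + pinner mu p q2.
Proof.
rewrite /pinner -cintegralD; [|exact: regular_pinner|exact: regular_pinner].
by congr cintegral; apply/funext => z; rewrite hornerD mulrDr.
Qed.

Lemma pinnerZr p c q : pinner mu p (c *: q) = c * pinner mu p q.
Proof.
rewrite /pinner -cintegralZ; last exact: regular_pinner.
by congr cintegral; apply/funext => z; rewrite hornerZ mulrCA.
Qed.

Lemma pinnerC p q : pinner mu q p = (pinner mu p q)^*.
Proof.
rewrite /pinner -cintegral_conj; last exact: regular_pinner.
by congr cintegral; apply/funext => z; rewrite rmorphM /= conjCK mulrC.
Qed.

Lemma pinner_sqnorm p : pinner mu p p = (sqnorm p)%:C.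
Proof.
rewrite /pinner -cintegral_real; congr cintegral; apply/funext => z.
by rewrite sqr_cmod mulrC.
Qed.

Lemma sqnorm_ge0 p : 0 <= sqnorm p.
Proof. by apply: Rintegral_ge0 => z _; rewrite sqr_ge0. Qed.

Lemma pinner0r p : pinner mu p 0 = 0.
Proof. by rewrite -(scale0r 0) pinnerZr mul0r. Qed.

Lemma pinnerDl p1 p2 q : pinner mu (p1 + p2) q = pinner mu p1 q + pinner mu p2 q.
Proof. by rewrite pinnerC pinnerDr rmorphD /= -!pinnerC. Qed.

Lemma pinnerZl p c q : pinner mu (c *: p) q = c^* * pinner mu p q.
Proof. by rewrite pinnerC pinnerZr rmorphM /= -pinnerC. Qed.

Lemma sqnormD p q : pinner mu p q = 0 -> sqnorm (p + q) = sqnorm p + sqnorm q.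
Proof.
move=> pq; apply: complexI; rewrite rmorphD /= -!pinner_sqnorm.
by rewrite pinnerDl !pinnerDr pq (pinnerC p q) pq conjC0 addr0 add0r.
Qed.

Lemma sqnormZ c p : sqnorm (c *: p) = cmod c ^+ 2 * sqnorm p.
Proof.
apply: complexI; rewrite rmorphM /= -!pinner_sqnorm pinnerZl pinnerZr mulrA.
by rewrite sqr_cmod (mulrC c).
Qed.

End Regular.

(** * Point masses *)

Section PointMass.
Variables (R : realType) (mu : probability (borel_circle R) R).
Local Notation T := (borel_circle R).
Implicit Types (p q : {poly R[i]}) (zeta : unit_circle R).

Lemma continuous_sqr_horner p :
  continuous (fun z : unit_circle R => cmod p.[circle_val z] ^+ 2).
Proof.
have [h1 h2 _] := regular_horner p.
under eq_fun do rewrite sqr_cmodE.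
move=> z; apply: (continuousD (continuousM (h1 z) (h1 z)) (continuousM (h2 z) (h2 z))).
Qed.

Lemma sqr_horner_integrable p :
  mu.-integrable setT (EFin \o (fun z : T => cmod p.[circle_val z] ^+ 2)).
Proof.
have [_ _ [M hM]] := regular_horner p.
apply: (bounded_integrable mu (M := M ^+ 2)).
  by apply: measurable_continuous_circle; exact: continuous_sqr_horner.
move=> z; rewrite ger0_norm ?sqr_ge0 // lerXn2r ?nnegrE ?cmod_ge0 //.
exact: le_trans (cmod_ge0 _) (hM z).
Qed.

(** The inequality of Chebyshev for |p|^2. *)
Lemma sqnorm_ge_measure p (A : set T) c : measurable A -> 0 <= c ->
  (forall z, A z -> c <= cmod p.[circle_val z] ^+ 2) -> c * fine (mu A) <= sqnorm mu p.
Proof.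
move=> mA c0 hA.
have iA : mu.-integrable setT (EFin \o (fun z => c * \1_A z)).
  apply: (bounded_integrable mu (M := c)).
    by apply: measurable_funM; [exact: measurable_cst|exact: measurable_indic].
  move=> z; rewrite indicE ger0_norm ?mulr_ge0 //; case: (z \in A); rewrite ?mulr1 ?mulr0 //.
have i1 : mu.-integrable setT (EFin \o (\1_A : T -> R)).
  apply: (bounded_integrable mu (M := 1)); first exact: measurable_indic.
  by move=> z; rewrite indicE; case: (z \in A); rewrite ?normr1 ?normr0.
have -> : c * fine (mu A) = Rintegral mu setT (fun z => c * \1_A z).
  by rewrite RintegralZl // /Rintegral integral_indic // setIT.
apply: le_Rintegral => //; first exact: sqr_horner_integrable.
move=> z _; rewrite indicE; case: (boolP (z \in A)) => [|_].
  by rewrite inE mulr1 => /hA.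
by rewrite mulr0 sqr_ge0.
Qed.

(** Around a point of the support that is not a root, |p|^2 is bounded below on a set of
    positive measure; so a polynomial of norm 0 would vanish on the infinite support. *)
Lemma sqnorm_gt0 p : infinite_set (msupport mu) -> p != 0 -> 0 < sqnorm mu p.
Proof.
move=> inf p0; rewrite lt_def sqnorm_ge0 andbT; apply/eqP => n0; apply: inf.
have [rs prs] := closed_field_poly_normal p.
apply: (@sub_finite_set _ _ (@circle_val R @^-1` [set` rs])); last first.
  apply: finite_preimage; last exact: finite_seq.
  by move=> z w _ _ /val_inj.
move=> z zsupp; rewrite /= -root_prod_XsubC -(rootZ _ _ (_ : lead_coef p != 0)); last first.
  by rewrite lead_coef_eq0.
rewrite -prs; apply: contrapT => /negP; rewrite rootE => pz.
pose c := cmod p.[circle_val z] ^+ 2 / 2.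
have c2 : c < cmod p.[circle_val z] ^+ 2.
  by rewrite /c gtr_pMr ?exprn_gt0 ?cmod_gt0 // invf_lt1 // ltr1n.
have c0 : 0 < c by rewrite divr_gt0 ?exprn_gt0 ?cmod_gt0.
pose U := [set w : unit_circle R | c < cmod p.[circle_val w] ^+ 2].
have oU : open U.
  have -> : U = (fun w => cmod p.[circle_val w] ^+ 2) @^-1` [set r : R | c < r] by [].
  by apply: open_comp => [w _|]; [exact: continuous_sqr_horner|exact: open_gt].
have mU : measurable (U : set T) by apply: sub_sigma_algebra.
have muU := zsupp _ oU c2.
have := sqnorm_ge_measure mU (ltW c0) (fun w (h : U w) => ltW h).
rewrite n0 leNgt mulr_gt0 // fine_gt0 // muU /=.
by rewrite (le_lt_trans (probability_le1 mu mU)) ?ltry.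
Qed.

Lemma measurable_point zeta : measurable ([set zeta] : set T).
Proof.
have [h1 h2 _] := regular_circle_val R.
have -> : ([set zeta] : set T) =
    (fun z : T => complex.Re (circle_val z)) @^-1` [set complex.Re (circle_val zeta)] `&`
    (fun z : T => complex.Im (circle_val z)) @^-1` [set complex.Im (circle_val zeta)].
  apply/seteqP; split=> [z -> //|z /= [e1 e2]]; apply: val_inj => /=.
  by apply/eqP; rewrite eq_complex; apply/andP; split; apply/eqP.
apply: measurableI; rewrite -[X in measurable X]setTI.
  exact: (@measurable_continuous_circle R _ h1).
exact: (@measurable_continuous_circle R _ h2).
Qed.

Lemma mass_fin_num zeta : mu [set zeta] \is a fin_num.
Proof. by apply: fin_num_measure; exact: measurable_point. Qed.

Lemma mass_le_sqnorm zeta p :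
  cmod p.[circle_val zeta] ^+ 2 * fine (mu [set zeta]) <= sqnorm mu p.
Proof.
apply: sqnorm_ge_measure; [exact: measurable_point|exact: sqr_ge0|].
by move=> z ->.
Qed.

(** Its modulus is 1 at zeta and smaller elsewhere on the circle. *)
Definition peak zeta : {poly R[i]} := 2^-1 *: (1 + (circle_val zeta)^* *: 'X).

Lemma circle_valJ zeta : circle_val zeta * (circle_val zeta)^* = 1.
Proof. by case: zeta => z hz; rewrite /= -normCK (eqP hz) expr1n. Qed.

Lemma cmod_circle_val zeta : cmod (circle_val zeta) = 1.
Proof. by apply: complexI; rewrite -normE; case: zeta => z /= /eqP. Qed.

Lemma peak_at zeta : (peak zeta).[circle_val zeta] = 1.
Proof.
by rewrite /peak !hornerE [_^* * _]mulrC circle_valJ mulVf // pnatr_eq0.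
Qed.

Lemma peak_lt1 zeta z : z <> zeta -> cmod (peak zeta).[circle_val z] < 1.
Proof.
move=> zz; rewrite /peak !hornerE; set w := (circle_val zeta)^* * circle_val z.
have w1 : cmod w = 1 by rewrite cmodM cmod_conj !cmod_circle_val mulr1.
have : w != 1.
  apply: contra_not_neq zz => w1'; apply: val_inj.
  transitivity (circle_val zeta * (circle_val zeta)^* * circle_val z).
    by rewrite circle_valJ mul1r.
  by rewrite -mulrA -/w w1' mulr1.
rewrite cmodM cmodV (_ : cmod 2 = 2); last first.
  by rewrite -[2 in LHS](rmorph_nat (real_complex R)) cmod_real normr_nat.
move=> w1'; rewrite mulrC ltr_pdivrMr ?mul1r //.
have ReIm : complex.Re w ^+ 2 + complex.Im w ^+ 2 = 1 by rewrite -sqr_cmodE w1 expr1n.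
have Rw : complex.Re w < 1.
  rewrite lt_neqAle (le_trans (ler_norm _)) ?andbT -?w1 ?Re_le_cmod //.
  apply: contra_neq w1' => Rw1; apply/eqP; rewrite eq_complex /= Rw1 w1 eqxx /=.
  by rewrite -sqrf_eq0; apply/eqP; move: ReIm; rewrite Rw1 w1 expr1n; lra.
rewrite -ltr_sqr ?nnegrE ?cmod_ge0 // sqr_cmodE ReD ImD /=.
move: ReIm Rw; move: (complex.Re w) (complex.Im w) => a b; nra.
Qed.

Lemma peak_le1 zeta z : cmod (peak zeta).[circle_val z] <= 1.
Proof.
have [->|/peak_lt1/ltW//] := pselect (z = zeta).
by rewrite peak_at cmod1.
Qed.

(** The powers of the peak polynomial concentrate at zeta. *)
Lemma sqnorm_peak_cvg zeta :
  sqnorm mu (peak zeta ^+ n) @[n --> \oo] --> fine (mu [set zeta]).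
Proof.
pose f_ n (z : T) := (cmod ((peak zeta) ^+ n).[circle_val z] ^+ 2)%:E.
pose f (z : T) := (\1_[set zeta] z : R)%:E.
have mz := measurable_point zeta.
have f_1 n z : 0 <= cmod ((peak zeta) ^+ n).[circle_val z] ^+ 2 <= 1.
  rewrite sqr_ge0 horner_exp cmodX -exprM exprn_ile1 ?cmod_ge0 //.
  exact: peak_le1.
have [||||| _ _] := @dominated_convergence _ T R mu setT measurableT f_ f (cst 1%:E).
- move=> n; apply/measurable_EFinP; apply: measurable_continuous_circle.
  exact: continuous_sqr_horner.
- by apply/measurable_EFinP; exact: measurable_indic.
- apply: aeW => z _; rewrite /f_ /f.
  apply: cvg_EFin; first exact: nearW.
  rewrite indicE; have [zz|nz] := pselect (z = zeta).
    rewrite zz mem_set //= [X in X @ _ --> _](_ : _ = cst 1); first exact: cvg_cst.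
    by apply/funext => n /=; rewrite horner_exp peak_at expr1n cmod1 expr1n.
  rewrite memNset //= [X in X @ _ --> _](_ : _ =
      (fun n => (cmod (peak zeta).[circle_val z] ^+ 2) ^+ n)).
    apply: cvg_expr; rewrite ger0_norm ?sqr_ge0 // expr_lt1 ?cmod_ge0 //.
    exact: peak_lt1.
  by apply/funext => n /=; rewrite horner_exp cmodX -!exprM mulnC.
- apply: (bounded_integrable mu (M := 1)); first exact: measurable_cst.
  by move=> z; rewrite normr1.
- apply: aeW => z n _; rewrite /f_ lee_fin ger0_norm.
    by have /andP[] := f_1 n z.
  exact: sqr_ge0.
rewrite integral_indic // setIT => h; apply: fine_cvg.
by rewrite fineK ?mass_fin_num.
Qed.

End PointMass.

(** * Orthogonal polynomials *)

Section OrthogonalPolynomials.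
Variables (R : realType) (mu : probability (borel_circle R) R).
Variables (Phi : nat -> {poly R[i]}) (alpha : nat -> R[i]).
Hypothesis hmu : infinite_set (msupport mu).
Hypothesis hPhi : monic_orthogonal mu Phi.
Hypothesis halpha : verblunsky Phi alpha.
Implicit Types (p q : {poly R[i]}) (zeta : unit_circle R).

Lemma Phi_monic n : Phi n \is monic. Proof. by have [h _ _] := hPhi; exact: h. Qed.

Lemma size_Phi n : size (Phi n) = n.+1. Proof. by have [_ h _] := hPhi; exact: h. Qed.

Lemma Phi_lead n : (Phi n)`_n = 1.
Proof. by have := monicP (Phi_monic n); rewrite lead_coefE size_Phi. Qed.

Lemma sqnorm_Phi_gt0 n : 0 < sqnorm mu (Phi n).
Proof. by apply: sqnorm_gt0 => //; exact: monic_neq0 (Phi_monic n). Qed.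

Lemma size_sub_lead n p : (size p <= n.+1)%N -> (size (p - p`_n *: Phi n)%R <= n)%N.
Proof.
move=> /leq_sizeP hp; apply/leq_sizeP => j; rewrite leq_eqVlt => /orP[/eqP <-|nj].
  by rewrite coefB coefZ Phi_lead mulr1 subrr.
rewrite coefB coefZ (hp j nj) (nth_default _ (_ : (size (Phi n) <= j)%N)) ?size_Phi //.
by rewrite mulr0 subr0.
Qed.

Lemma Phi_orthogonal_low n m p : (size p <= n)%N -> (n <= m)%N -> pinner mu (Phi m) p = 0.
Proof.
elim: n p => [|n IH] p; first by rewrite leqn0 size_poly_eq0 => /eqP -> _; exact: pinner0r.
move=> /size_sub_lead/IH h nm.
have pE : p = p - p`_n *: Phi n + p`_n *: Phi n by rewrite subrK.
rewrite [p in pinner _ _ p]pE pinnerDr pinnerZr.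
rewrite h 1?ltnW //; have [_ _ -> ] := hPhi; first by rewrite mulr0 addr0.
by rewrite gtn_eqF.
Qed.

Lemma pinner_orthogonal_low n m p : (size p <= n)%N -> (n <= m)%N -> pinner mu p (Phi m) = 0.
Proof. by move=> h1 h2; rewrite pinnerC (Phi_orthogonal_low h1 h2) conjC0. Qed.

Lemma circle_neq0 zeta : circle_val zeta != 0.
Proof. by rewrite -cmod_gt0 cmod_circle_val. Qed.

Lemma reversed_circle n p zeta :
  reversed n p (circle_val zeta) = circle_val zeta ^+ n * (p.[circle_val zeta])^*.
Proof.
have zJ : (circle_val zeta)^* != 0 by rewrite conjC_eq0 circle_neq0.
have e : 1 / (circle_val zeta)^* = circle_val zeta.
  by apply: (mulIf zJ); rewrite divfK // circle_valJ.
by rewrite /reversed e.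
Qed.

Lemma eq_sqnorm p q c :
  (forall z : unit_circle R, cmod p.[circle_val z] = c * cmod q.[circle_val z]) ->
  sqnorm mu p = c ^+ 2 * sqnorm mu q.
Proof.
move=> h; rewrite /sqnorm -RintegralZl //; last exact: sqr_horner_integrable.
by apply: eq_Rintegral => z _; rewrite h exprMn.
Qed.

(** z Phi_n is the orthogonal sum of Phi_(n+1) and of a multiple of the reversed
    polynomial, which has degree at most n and the modulus of Phi_n on the circle. *)
Lemma sqnorm_Phi_next n :
  sqnorm mu (Phi n.+1) = (1 - cmod (alpha n) ^+ 2) * sqnorm mu (Phi n).
Proof.
pose Q := 'X * Phi n - Phi n.+1.
have sQ : (size Q <= n.+1)%N.
  have := @size_sub_lead n.+1 ('X * Phi n); rewrite coefXM Phi_lead scale1r; apply.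
  by rewrite (leq_trans (size_polyMleq _ _)) // size_polyX size_Phi.
have NQ : sqnorm mu Q = cmod (alpha n) ^+ 2 * sqnorm mu (Phi n).
  apply: eq_sqnorm => z; rewrite hornerD hornerN hornerM hornerX.
  rewrite halpha ?circle_neq0 // reversed_circle subKr !cmodM cmodX !cmod_conj.
  by rewrite cmod_circle_val expr1n mul1r.
have NX : sqnorm mu ('X * Phi n) = sqnorm mu (Phi n).
  rewrite -[RHS]mul1r -[1](expr1n _ 2); apply: eq_sqnorm => z.
  by rewrite hornerM hornerX cmodM cmod_circle_val.
have : sqnorm mu (Phi n.+1 + Q) = sqnorm mu (Phi n.+1) + sqnorm mu Q.
  by apply: sqnormD; exact: (Phi_orthogonal_low sQ (leqnn _)).
rewrite {1}/Q addrC subrK NX NQ; lra.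
Qed.

Lemma cmod_alpha n : cmod (alpha n) < 1.
Proof.
have := sqnorm_Phi_gt0 n.+1; rewrite sqnorm_Phi_next pmulr_lgt0 ?sqnorm_Phi_gt0 //.
by rewrite subr_gt0 expr_lt1 ?cmod_ge0.
Qed.

Local Notation phi := (orthonormal_of mu Phi).

Lemma pnorm_gt0 n : 0 < pnorm mu (Phi n).
Proof. by rewrite /pnorm sqrtr_gt0; exact: sqnorm_Phi_gt0. Qed.

Lemma sqr_pnorm n : pnorm mu (Phi n) ^+ 2 = sqnorm mu (Phi n).
Proof. by rewrite /pnorm sqr_sqrtr //; exact: sqnorm_ge0. Qed.

Lemma pnorm_next n :
  pnorm mu (Phi n.+1) = Num.sqrt (1 - cmod (alpha n) ^+ 2) * pnorm mu (Phi n).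
Proof.
rewrite [LHS]/pnorm -/(sqnorm mu (Phi n.+1)) sqnorm_Phi_next sqrtrM //.
by rewrite subr_ge0 expr_le1 ?cmod_ge0 // ltW // cmod_alpha.
Qed.

Lemma phi_next n zeta : let z := circle_val zeta in
  (phi n.+1).[z] =
    (rho alpha n)^-1 * (z * (phi n).[z] - (alpha n)^* * (z ^+ n * ((phi n).[z])^*)).
Proof.
move=> z; rewrite /orthonormal_of !hornerZ halpha ?circle_neq0 // reversed_circle.
have -> : ((pnorm mu (Phi n.+1))^-1)%:C = (rho alpha n)^-1 * ((pnorm mu (Phi n))^-1)%:C.
  by rewrite pnorm_next invfM rmorphM /= [X in X * _]fmorphV.
have NJ : (((pnorm mu (Phi n))^-1)%:C)^* = ((pnorm mu (Phi n))^-1)%:C by exact: conjc_real.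
by rewrite rmorphM /= NJ -/z; ring.
Qed.

Lemma sqnorm_phi n : sqnorm mu (phi n) = 1.
Proof.
rewrite /orthonormal_of sqnormZ cmod_real real_normK ?num_real // exprVn sqr_pnorm.
by rewrite mulVf // gt_eqF // sqnorm_Phi_gt0.
Qed.

Lemma sqnormDphi n p c : (size p <= n)%N ->
  sqnorm mu (p + c *: phi n) = sqnorm mu p + cmod c ^+ 2.
Proof.
move=> sp; rewrite sqnormD; last first.
  by rewrite !pinnerZr (pinner_orthogonal_low sp) ?mulr0.
by rewrite sqnormZ sqnorm_phi mulr1.
Qed.

Lemma size_phi n c : (size (c *: phi n)%R <= n.+1)%N.
Proof. by rewrite scalerA (leq_trans (size_scale_leq _ _)) // size_Phi. Qed.

(** Cauchy-Schwarz in the orthonormal basis phi_0, ..., phi_n. *)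
Lemma christoffel n p zeta : (size p <= n.+1)%N ->
  cmod p.[circle_val zeta] ^+ 2 <= CDkernel phi n (circle_val zeta) * sqnorm mu p.
Proof.
elim: n p => [|n IH] p sp.
  have /size_sub_lead := sp; rewrite leqn0 size_poly_eq0 => /eqP /subr0_eq pE.
  have pE' : p = (p`_0 * (pnorm mu (Phi 0%N))%:C) *: phi 0%N.
    by rewrite scalerA -mulrA -rmorphM divff ?mulr1 // gt_eqF // pnorm_gt0.
  rewrite /CDkernel big_nat1 pE'.
  by rewrite sqnormZ sqnorm_phi mulr1 hornerZ cmodM exprMn mulrC.
pose c := p`_n.+1 * (pnorm mu (Phi n.+1))%:C.
have cE : p`_n.+1 *: Phi n.+1 = c *: phi n.+1.
  by rewrite scalerA -mulrA -rmorphM divff ?mulr1 // gt_eqF // pnorm_gt0.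
pose q := p - c *: phi n.+1.
have sq : (size q <= n.+1)%N by rewrite /q -cE; exact: size_sub_lead.
have -> : p = q + c *: phi n.+1 by rewrite subrK.
rewrite sqnormDphi // hornerD hornerZ.
have {}IH := IH q sq; move: IH; rewrite /CDkernel [in X in _ -> X]big_nat_recr //=.
set K := \sum_(_ <= _ < _) _.
have K0 : 0 <= K by apply: sumr_ge0 => j _; rewrite sqr_ge0.
have A0 := sqnorm_ge0 mu q.
move: (sqnorm mu q) A0 => A A0.
move: (q.[_]) ((phi _).[_]) => u v uKA.
have sq1 : cmod (u + c * v) ^+ 2 <= (cmod u + cmod c * cmod v) ^+ 2.
  by rewrite ler_sqr ?nnegrE ?addr_ge0 ?mulr_ge0 ?cmod_ge0 // -cmodM cmodD.
apply: le_trans sq1 _.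
move: (cmod_ge0 u) (cmod_ge0 v) (cmod_ge0 c); move: uKA.
move: (cmod u) (cmod v) (cmod c) => U V W UKA U0 V0 W0.
(* the cross term is bounded by the arithmetic-geometric mean inequality *)
have cross : 2 * U * W * V <= K * W ^+ 2 + A * V ^+ 2.
  rewrite -ler_sqr ?nnegrE ?addr_ge0 ?mulr_ge0 ?sqr_ge0 //.
  have h1 : (2 * U * W * V) ^+ 2 = 4 * (U ^+ 2 * (W * V) ^+ 2) by ring.
  have h2 : U ^+ 2 * (W * V) ^+ 2 <= K * A * (W * V) ^+ 2.
    by rewrite ler_wpM2r ?sqr_ge0.
  have h3 := sqr_ge0 (K * W ^+ 2 - A * V ^+ 2).
  have h4 : (K * W ^+ 2 + A * V ^+ 2) ^+ 2 =
    (K * W ^+ 2 - A * V ^+ 2) ^+ 2 + 4 * (K * A * (W * V) ^+ 2) by ring.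
  rewrite h1 h4; lra.
have -> : (U + W * V) ^+ 2 = U ^+ 2 + 2 * U * W * V + W ^+ 2 * V ^+ 2 by ring.
have -> : (K + V ^+ 2) * (A + W ^+ 2) =
  K * A + (K * W ^+ 2 + A * V ^+ 2) + W ^+ 2 * V ^+ 2 by ring.
by rewrite lerD2r lerD.
Qed.

(** The reproducing kernel K_n(., zeta), for which [christoffel] is an equality. *)
Lemma kernel_polynomial n zeta : exists p, [/\ (size p <= n.+1)%N,
  p.[circle_val zeta] = (CDkernel phi n (circle_val zeta))%:C &
  sqnorm mu p = CDkernel phi n (circle_val zeta)].
Proof.
rewrite /CDkernel; elim: n => [|n [p [sp pz Np]]].
  exists (((phi 0%N).[circle_val zeta])^* *: phi 0%N); split; first exact: size_phi.
    by rewrite big_nat1 hornerZ sqr_cmod mulrC.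
  by rewrite big_nat1 sqnormZ sqnorm_phi mulr1 cmod_conj.
exists (p + ((phi n.+1).[circle_val zeta])^* *: phi n.+1); split.
- by rewrite (leq_trans (size_polyD _ _)) // geq_max size_phi andbT ltnW.
- by rewrite hornerD hornerZ pz [in RHS]big_nat_recr //= rmorphD /= sqr_cmod [X in _ + X]mulrC.
- by rewrite sqnormDphi // Np [in RHS]big_nat_recr //= cmod_conj.
Qed.

Lemma CDkernel_ge0 n z : 0 <= CDkernel phi n z.
Proof. by apply: sumr_ge0 => j _; rewrite sqr_ge0. Qed.

Lemma CDkernelE n z : CDkernel phi n z = \sum_(j < n.+1) cmod (phi j).[z] ^+ 2.
Proof. by rewrite /CDkernel big_mkord. Qed.

Lemma point_mass_cases zeta : mu [set zeta] = 0%E \/ (0 < mu [set zeta])%E.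
Proof.
have := measure_ge0 mu [set zeta].
by rewrite le_eqVlt => /orP[/eqP <-|]; [left|right].
Qed.

(** By [christoffel] all powers of the peak polynomial have squared norm at least 1 /
    sum_j |phi_j(zeta)|^2, and these norms tend to mu {zeta}. *)
Lemma point_mass_of_summ zeta :
  summ (fun n => cmod (phi n).[circle_val zeta] ^+ 2) -> (0 < mu [set zeta])%E.
Proof.
move=> [M hM].
pose M' := `|M| + 1; have M'0 : 0 < M' by rewrite ltr_wpDl.
have KM n : CDkernel phi n (circle_val zeta) <= M'.
  rewrite CDkernelE; apply: le_trans (hM n.+1) _; rewrite /M'.
  by have := ler_norm M; lra.
have low n : M'^-1 <= sqnorm mu (peak zeta ^+ n).
  have sz : (size (peak zeta ^+ n)%R <= n.+1)%N.
    apply: leq_trans (size_poly_exp_leq _ _) _; rewrite ltnS -[leqRHS]mul1n leq_mul2r.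
    rewrite /peak; apply/orP; right; rewrite -subn1 leq_subLR.
    rewrite (leq_trans (size_scale_leq _ _)) // (leq_trans (size_polyD _ _)) // geq_max.
    by rewrite size_poly1 /= (leq_trans (size_scale_leq _ _)) // size_polyX.
  have := christoffel zeta sz.
  rewrite horner_exp peak_at expr1n cmod1 expr1n => h.
  rewrite -[leLHS]mul1r ler_pdivrMr // mulrC; apply: le_trans h _.
  by rewrite ler_wpM2r ?sqnorm_ge0.
have : M'^-1 <= fine (mu [set zeta]).
  by apply: (@cvgr_to_ge nat \oo _ R _ _ _ (@sqnorm_peak_cvg R mu zeta)); exact: nearW.
move=> h; have f0 : 0 < fine (mu [set zeta]) by rewrite (lt_le_trans _ h) // invr_gt0.
by rewrite -(fineK (mass_fin_num mu zeta)) lte_fin.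
Qed.

(** Testing mu {zeta} against the kernel polynomial gives mu {zeta} K_n^2 <= K_n. *)
Lemma no_point_mass_of_not_summ zeta :
  ~ summ (fun n => cmod (phi n).[circle_val zeta] ^+ 2) -> mu [set zeta] = 0%E.
Proof.
move=> ns; have [//|m0] := point_mass_cases zeta; exfalso; apply: ns.
pose m := fine (mu [set zeta]).
have m_gt0 : 0 < m by rewrite -lte_fin (fineK (mass_fin_num mu zeta)).
exists m^-1 => -[|n]; first by rewrite big_ord0 invr_ge0 ltW.
rewrite -CDkernelE; set K := CDkernel _ _ _.
have [p [_ pz Np]] := kernel_polynomial n zeta.
have K0 : 0 <= K by exact: CDkernel_ge0.
have h : K ^+ 2 * m <= K.
  by have := mass_le_sqnorm mu zeta p; rewrite pz Np cmod_real ger0_norm.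
have [->|Kn0] := eqVneq K 0; first by rewrite invr_ge0 ltW.
have Kp : 0 < K by rewrite lt_def Kn0.
rewrite -[leRHS]mul1r ler_pdivlMr // -(ler_pM2l Kp) mulr1 mulrA -expr2.
exact: h.
Qed.

End OrthogonalPolynomials.

(** * The perturbation by a point mass *)

Section Assembly.
Variables (R : realType) (mu : probability (borel_circle R) R).
Variables (Phi : nat -> {poly R[i]}) (alpha : nat -> R[i]).
Hypothesis hmu : infinite_set (msupport mu).
Hypothesis hPhi : monic_orthogonal mu Phi.
Hypothesis halpha : verblunsky Phi alpha.
Variables (zeta : unit_circle R) (s : R[i]).
Hypothesis s2 : s ^+ 2 = circle_val zeta.
Hypothesis ss : s * s^* = 1.

Local Notation phi := (orthonormal_of mu Phi).

(** The factor s^-n, with s^2 = zeta, turns the pair formed by phi_n(zeta) and the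
    reversed polynomial at zeta into a pair of conjugate numbers. *)
Definition szego_orbit n : R[i] := (s^*) ^+ n * (phi n).[circle_val zeta].

Lemma phi_orbit n : (phi n).[circle_val zeta] = s ^+ n * szego_orbit n.
Proof. by rewrite /szego_orbit mulrA -exprMn ss expr1n mul1r. Qed.

Lemma cmod_szego_orbit n : cmod (szego_orbit n) = cmod (phi n).[circle_val zeta].
Proof. by rewrite cmodM cmodX cmod_conj (cmod_s ss) expr1n mul1r. Qed.

Lemma szego_orbit_next n : szego_orbit n.+1 = (rho alpha n)^-1 *
  (s * szego_orbit n - (alpha n)^* * s^* * (szego_orbit n)^*).
Proof.
rewrite {1}/szego_orbit (phi_next hmu hPhi halpha) phi_orbit -s2 rmorphM rmorphXn /=.
move: (rho alpha n)^-1 (szego_orbit n) ((szego_orbit n)^*) => r u v.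
have e : s ^+ n * (s^*) ^+ n = 1 by rewrite -exprMn ss expr1n.
rewrite -exprM mulnC exprM.
transitivity (r * (s * s^* * (s ^+ n * (s^*) ^+ n) * (s * u) -
   (alpha n)^* * s^* * ((s ^+ n * (s^*) ^+ n) ^+ 2 * v))).
  by rewrite exprS; ring.
by rewrite e ss expr1n !mul1r.
Qed.

Lemma szego_orbit0 : szego_orbit 0 != 0.
Proof.
rewrite /szego_orbit expr0 mul1r /orthonormal_of hornerZ mulf_neq0 //.
  by rewrite -cmod_gt0 cmod_real normr_gt0 invr_eq0 gt_eqF // (pnorm_gt0 hmu hPhi).
have := size_Phi hPhi 0; have := Phi_lead hPhi 0 => h1 h0.
by rewrite (size1_polyC (eq_leq h0)) hornerC h1 oner_neq0.
Qed.

Lemma Delta_orbit gamma n : Delta mu Phi alpha gamma zeta n =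
  orbit_delta alpha s szego_orbit ((1 - gamma) * gamma^-1) n.
Proof.
rewrite /Delta /orbit_delta.
have -> : CDkernel phi n (circle_val zeta) =
    \sum_(0 <= j < n.+1) cmod (szego_orbit j) ^+ 2.
  by apply: eq_bigr => j _; rewrite cmod_szego_orbit.
congr (_ / _); rewrite -/(rho alpha n) reversed_circle !phi_orbit szego_orbit_next -s2.
have r0 := rho_neq0 (cmod_alpha hmu hPhi halpha n).
have e : s ^+ n * (s^*) ^+ n = 1 by rewrite -exprMn ss expr1n.
rewrite sqr_cmod; move: (conj_rho alpha n); move: (rho alpha n) r0 (szego_orbit n).
move=> r r0 u rJ; rewrite !rmorphM rmorphB !rmorphM !rmorphXn fmorphV /= !conjCK rJ.
move: (u^*) => v; rewrite -exprM mulnC exprM.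
transitivity ((s ^+ n * (s^*) ^+ n) ^+ 2 * s^* * (s^* * v - alpha n * s * u) * v).
  by rewrite exprS; field.
rewrite e expr1n mul1r.
transitivity ((s^*) ^+ 2 * v ^+ 2 - (s * s^*) * alpha n * (u * v)); first by ring.
by rewrite ss mul1r.
Qed.

End Assembly.

Unset Implicit Arguments.

Theorem theorem2p2 (R : realType)
  (p : nat) (hp : (1 <= p)%N)
  (beta : nat -> R[i])
  (hbeta : forall n, cmod (beta n) < 1)
  (hper : forall n, beta n = beta (n + p)%N)
  (mu : probability (borel_circle R) R)
  (hmu : infinite_set (msupport mu))
  (Phi : nat -> {poly R[i]}) (hPhi : monic_orthogonal mu Phi)
  (alpha : nat -> R[i]) (halpha : verblunsky Phi alpha)
  (hlim : (alpha n - beta n : R[i]^o) @[n --> \oo] --> (0 : R[i]^o))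
  (hsum : (\sum_(0 <= n <oo) (cmod (alpha (n + p)%N - alpha n))%:E < +oo)%E)
  (zeta : unit_circle R)
  (hzeta : ~ closure (Gamma_bands beta p : set R[i]^o) (circle_val zeta))
  (gamma : R) (hgamma : 0 < gamma < 1)
  (nu : probability (borel_circle R) R)
  (hnu : forall A : set (borel_circle R), measurable A ->
     nu A = ((1 - gamma)%:E * mu A + gamma%:E * \d_(zeta : borel_circle R) A)%E) :
  let D := Delta mu Phi alpha gamma zeta in
  ((0 < mu [set zeta])%E /\
   forall j, (j < p)%N ->
     exponentially_fast (fun k => D (k * p + j)%N))
  \/
  (mu [set zeta] = 0%E /\
   forall j, (j < p)%N ->
     cvgn (fun k => D (k * p + j)%N : R[i]^o) /\
     (\sum_(0 <= k <oo) (cmod (D (k.+1 * p + j)%N - D (k * p + j)%N))%:E < +oo)%E).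
Proof.
move=> D.
have [t zt] := unimodular_expi (svalP zeta).
pose s : R[i] := expi (t / 2).
have s2 : s ^+ 2 = circle_val zeta by rewrite /s expi_half -zt.
have ss : s * s^* = 1 by exact: expiJ.
have hal := cmod_alpha hmu hPhi halpha.
have hlim' : tends (fun n => alpha n - beta n) 0 by apply/tendsP.
have ge0 (u : nat -> R[i]) k : 0 <= cmod (u k) by exact: cmod_ge0.
have hsum' : summ (fun n => cmod (alpha (n + p)%N - alpha n)).
  exact: (proj2 (summP (ge0 (fun n => alpha (n + p)%N - alpha n))) hsum).
have hyper : 1 < `|complex.Re (ta beta s p)|.
  by apply: (hyperbolic_off_bands hbeta hp (t := t)); rewrite -zt.
have c0 : 0 < (1 - gamma) * gamma^-1.
  by case/andP: hgamma => g0 g1; rewrite mulr_gt0 ?invr_gt0 ?subr_gt0.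
have DE n : D n = orbit_delta alpha s (szego_orbit mu Phi zeta s) ((1 - gamma) * gamma^-1) n.
  exact: Delta_orbit.
have sqE : (fun n => cmod (szego_orbit mu Phi zeta s n) ^+ 2) =
    (fun n => cmod (orthonormal_of mu Phi n).[circle_val zeta] ^+ 2).
  by apply/funext => n; rewrite cmod_szego_orbit.
have [] := orbit_dichotomy hp hal hbeta hper hlim' hsum' ss
  (szego_orbit0 hmu hPhi zeta s) (szego_orbit_next hmu hPhi halpha s2 ss) hyper c0.
  rewrite sqE => -[hs he]; left; split; first exact: point_mass_of_summ hs.
  by move=> j _; have := he j; congr exponentially_fast; apply/funext => k; rewrite DE.
rewrite sqE => -[hs hb]; right; split; first exact: no_point_mass_of_not_summ hs.
move=> j _; have bD : bv (fun k => D (k * p + j)%N).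
  by apply: eq_bv (hb j) => k; rewrite DE.
split; last exact: (proj1 (summP (ge0 (fun k => D (k.+1 * p + j)%N - D (k * p + j)%N))) bD).
by have [l /tendsP hl] := bv_tends bD; apply/cvg_ex; exists l.
Qed.
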